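(* Let $A$ be a finite alphabet and $\{F_a:a\in A\}$ a Möbius iterative system. Assume that there exists a finite subset $B$ of $A^+$ such that $\{\overline{V_b}:b\in B\}$ is a cover of $\mathbb{T}$, where $V_b$ is the expansion interval of $F_b^{-1}$. Then there exists a subshift $\Sigma\subseteq A^\omega$ that is a Möbius number system for the iterative system $\{F_a:a\in A\}$.
   Context: $\mathbb{T}$ is the unit circle in $\mathbb{C}$. A disc preserving Möbius transformation is a map $F(z)=\frac{\alpha z+\beta}{\overline\beta z+\overline\alpha}$ with $|\alpha|^2-|\beta|^2=1$. Put $F^{\bullet}(x)=|F'(x)|$. The expansion interval of $F^{-1}$ is $\{x\in\mathbb{T}:(F^{-1})^{\bullet}(x)>1\}$ (empty if $F$ is a rotation $z\mapsto e^{i\phi}z$). $A^+$ is the set of nonempty finite words over $A$, $A^\omega$ the set of one-sided infinite words with the product topology; $w_{[0,n)}=w_0\cdots w_{n-1}$. A subshift is a closed set $\Sigma\subseteq A^\omega$ with $\sigma(\Sigma)\subseteq\Sigma$, where $\sigma(w)_i=w_{i+1}$. A Möbius iterative system is a family $\{F_a:a\in A\}$ of disc preserving Möbius transformations. For $v=v_0\cdots v_{n-1}$ put $F_v=F_{v_0}\circ\cdots\circ F_{v_{n-1}}$. A sequence $\{G_n\}$ of disc preserving Möbius transformations represents $x\in\mathbb{T}$ if $G_n\mu\to\delta_x$ weakly$^*$, where $\mu$ is the uniform probability measure on $\mathbb{T}$ and $G\mu(E)=\mu(G^{-1}(E))$. For $w\in A^\omega$, $\Phi(w)$ is the point $x\in\mathbb{T}$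 represented by $\{F_{w_{[0,n)}}\}_{n=1}^\infty$ if it exists, and is undefined otherwise. A subshift $\Sigma\subseteq A^\omega$ is a Möbius number system for $\{F_a\}$ if $\Phi$ is defined on all of $\Sigma$, $\Phi(\Sigma)=\mathbb{T}$ and $\Phi|_{\Sigma}$ is continuous. *)

(* Defs.v *)
(* This development lives in the MathComp-Analysis world. *)
From HB Require Import structures.
From mathcomp Require Import all_boot all_order all_algebra.
From mathcomp Require Import all_classical all_reals all_analysis.
From mathcomp Require Import measurable_realfun ring.
From mathcomp.real_closed Require Import complex.

Set Implicit Arguments.
Unset Strict Implicit.
Unset Printing Implicit Defensive.

Import Order.TTheory GRing.Theory Num.Theory.
Import numFieldNormedType.Exports.

Local Open Scope classical_set_scope.
Local Open Scope ring_scope.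

(* R[i] packaged as a numClosedFieldType: on the bare type R[i] the topology
   and the normed-module structure of a numFieldType are not inferred.
   Norms live in C itself, ordered by x <= y iff y - x is real nonnegative. *)
Definition C (R : realType) : numClosedFieldType := R[i].

Section Circle.
Variable R : realType.

Definition unit_circle : set (C R) := [set z | `|z| = 1].

Definition circle : Type := set_type unit_circle.

HB.instance Definition _ := Choice.copy circle (set_type unit_circle).
HB.instance Definition _ := Topological.copy circle (set_type unit_circle).
HB.instance Definition _ := Uniform.copy circle (set_type unit_circle).

Definition mk_circle (z : C R) (hz : `|z| = 1) : circle := SigSub (mem_set hz).

Definition cval (x : circle) : C R := \val x.

Lemma circleP (x : circle) : `|cval x| = 1.
Proof. by have /set_mem := valP x. Qed.

HB.instance Definition _ := isPointed.Build circle (mk_circle (normr1 (C R))).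

HB.instance Definition _ :=
  Measurable.copy circle (g_sigma_algebraType (@open circle)).

Lemma norm_turn (t : R) :
  `|(cos (2 * pi * t) +i* sin (2 * pi * t))%C : C R| = 1.
Proof. by rewrite normc_def /= cos2Dsin2 sqrtr1. Qed.

(* t |-> exp (2 i pi t) *)
Definition turn (t : R) : circle := mk_circle (norm_turn t).

Lemma continuous_circle (T : topologicalType) (f : T -> circle) :
  continuous (cval \o f) -> continuous f.
Proof.
move=> h; exact: (@continuous_comp_initial _ _ _ (@set_val _ unit_circle) f h).
Qed.

Lemma continuous_cval : continuous cval.
Proof.
exact: (@initial_continuous (set_type unit_circle) (C R : topologicalType) set_val).
Qed.

Lemma continuous_measurable_circle (f : circle -> circle) :
  continuous f -> measurable_fun setT f.
Proof.
move=> cf; apply: (@measurability _ _ _ _ _ _ (@open circle)) => //.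
move=> _ [U oU <-]; rewrite setTI; apply: sub_sigma_algebra.
by apply: open_comp => // x _; apply: cf.
Qed.

Let sqrt_le (a b : R) : Num.sqrt (a ^+ 2 + b ^+ 2) <= `|a| + `|b|.
Proof.
rewrite -[leRHS]ger0_norm ?addr_ge0// -[leRHS]sqrtr_sqr ler_wsqrtr//.
rewrite sqrrD !real_normK ?num_real// -addrA lerD2l lerDr mulrn_wge0//.
Qed.

Lemma continuous_turn : continuous turn.
Proof.
apply: continuous_circle => t.
rewrite /= /cval /turn/=.
apply/cvgrPdist_lt => e e0.
have eR : e = ((complex.Re e)%:C)%C :> R[i].
  by have h := gtr0_real e0; exact/esym/RRe_real.
have e0' : 0 < complex.Re e by rewrite -ltcR -eR.
have ct : {for t, continuous (fun t : R => cos (2 * pi * t))}.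
  apply: continuous_comp; last exact: continuous_cos.
  by apply: cvgM; [exact: cvg_cst|exact: cvg_id].
have st : {for t, continuous (fun t : R => sin (2 * pi * t))}.
  apply: continuous_comp; last exact: continuous_sin.
  by apply: cvgM; [exact: cvg_cst|exact: cvg_id].
have e2 : 0 < complex.Re e / 2 by rewrite divr_gt0.
move/cvgrPdist_lt : ct => /(_ _ e2) ct.
move/cvgrPdist_lt : st => /(_ _ e2) st.
near=> s.
have h1 : `|cos (2 * pi * t) - cos (2 * pi * s)| < complex.Re e / 2 by near: s.
have h2 : `|sin (2 * pi * t) - sin (2 * pi * s)| < complex.Re e / 2 by near: s.
rewrite eR /= normc_def/= ltcR.
apply: (@le_lt_trans _ _ (`|cos (2 * pi * t) - cos (2 * pi * s)|
  + `|sin (2 * pi * t) - sin (2 * pi * s)|)).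
  exact: sqrt_le.
by rewrite [ltRHS](splitr (complex.Re e)) ltrD.
Unshelve. all: by end_near. Qed.

Lemma measurable_turn : measurable_fun setT turn.
Proof.
apply: (@measurability _ _ _ _ _ _ (@open circle)) => //.
move=> _ [U oU <-]; rewrite setTI; apply: open_measurable.
by apply: open_comp => // x _; apply: continuous_turn.
Qed.

Definition circle_measure : set circle -> \bar R :=
  pushforward (uniform_prob (@ltr01 R)) turn.

(* Real test functions suffice; boundedness is automatic, the circle being
   compact. *)
Definition weak_star_cvg (mu : nat -> set circle -> \bar R)
    (nu : set circle -> \bar R) : Prop :=
  forall f : circle -> R, continuous f ->
    (\int[mu n]_x (f x)%:E)%E @[n --> \oo] --> (\int[nu]_x (f x)%:E)%E.

End Circle.
Arguments circle_measure {R}.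

Lemma cvg_linear_frac (K : numClosedFieldType) (T : topologicalType)
    (f : T -> K) (x : T) (a b c d : K) :
  c * f x + d != 0 -> f @ x --> f x ->
  (fun z => (a * f z + b) / (c * f z + d)) @ x --> (a * f x + b) / (c * f x + d).
Proof.
move=> hd hx.
have lin (p q : K) : (fun z => p * f z + q) @ x --> p * f x + q.
  by apply: (@cvgD K K); [apply: (@cvgM K) => //; exact: cvg_cst|exact: cvg_cst].
apply: (@cvgM K); first exact: lin.
by apply: (@cvgV K) => //; exact: lin.
Qed.

Section Mobius.
Variable R : realType.
Local Notation C := (C R).
Local Notation circle := (circle R).

(* The coefficients of z |-> (a z + b) / (conj b z + conj a); (a, b) and
   (-a, -b) give the same map. *)
Record mobius := Mobius {
  mob_a : C ;
  mob_b : C ;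
  mobP : `|mob_a| ^+ 2 - `|mob_b| ^+ 2 = 1 }.

(* As a total function on C this has the junk value 0 at its pole, which lies
   outside the closed unit disc when it exists. *)
Definition mob_fun (F : mobius) (z : C) : C :=
  (mob_a F * z + mob_b F) / ((mob_b F)^* * z + (mob_a F)^*).

Lemma mob_denom_neq0 (F : mobius) (z : C) :
  `|z| <= 1 -> (mob_b F)^* * z + (mob_a F)^* != 0.
Proof.
case: F => a b /= hab hz; apply/negP => /eqP/eqP.
rewrite addr_eq0 => /eqP/(congr1 Num.norm).
rewrite normrM normrN !norm_conjC => h.
have : `|a| ^+ 2 <= `|b| ^+ 2.
  rewrite -h exprMn -[leRHS]mulr1 ler_wpM2l ?exprn_ge0//.
  by rewrite expr_le1.
by rewrite -subr_le0 hab ler10.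
Qed.

Lemma mob_fun_circle (F : mobius) (x : circle) : `|mob_fun F (cval x)| = 1.
Proof.
have hx := circleP x.
have hd : (mob_b F)^* * cval x + (mob_a F)^* != 0.
  by apply: mob_denom_neq0; rewrite hx.
rewrite /mob_fun normrM normfV.
have -> : `|mob_a F * cval x + mob_b F| = `|(mob_b F)^* * cval x + (mob_a F)^*|.
  rewrite -[RHS]norm_conjC rmorphD rmorphM/= !conjCK.
  rewrite -[RHS]mul1r -{1}hx -normrM mulrDr mulrCA -normCK hx expr1n mulr1.
  by rewrite addrC (mulrC (mob_a F)).
by rewrite mulfV// normr_eq0.
Qed.

Definition mob_act (F : mobius) (x : circle) : circle :=
  mk_circle (mob_fun_circle F x).

Lemma continuous_mob_act (F : mobius) : continuous (mob_act F).
Proof.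
apply: continuous_circle => x.
have hd : (mob_b F)^* * cval x + (mob_a F)^* != 0.
  by apply: mob_denom_neq0; rewrite circleP.
have hx : cval z @[z --> x] --> cval x by exact: continuous_cval.
exact: cvg_linear_frac.
Qed.

Lemma measurable_mob_act (F : mobius) : measurable_fun setT (mob_act F).
Proof. by apply: continuous_measurable_circle; exact: continuous_mob_act. Qed.

Lemma mob_idP : `|1 : C| ^+ 2 - `|0 : C| ^+ 2 = 1.
Proof. by rewrite normr1 normr0 expr1n expr0n subr0. Qed.

Definition mob_id : mobius := Mobius mob_idP.

Lemma mob_compP (F G : mobius) :
  `|mob_a F * mob_a G + mob_b F * (mob_b G)^*| ^+ 2
  - `|mob_a F * mob_b G + mob_b F * (mob_a G)^*| ^+ 2 = 1.
Proof.
case: F G => [a b hab] [c d hcd] /=.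
rewrite -[RHS]mulr1 -{1}hab -hcd !normCK !rmorphD !rmorphM/= !conjCK.
by rewrite !(mulrDl, mulrDr, mulrBl, mulrBr); ring.
Qed.

Definition mob_comp (F G : mobius) : mobius := Mobius (mob_compP F G).

Lemma mob_invP (F : mobius) : `|(mob_a F)^*| ^+ 2 - `|- mob_b F| ^+ 2 = 1.
Proof. by rewrite norm_conjC normrN mobP. Qed.

Definition mob_inv (F : mobius) : mobius := Mobius (mob_invP F).

Lemma mob_funM (F G : mobius) (z : C) : `|z| <= 1 ->
  mob_fun (mob_comp F G) z = mob_fun F (mob_fun G z).
Proof.
move=> hz; have hG := mob_denom_neq0 G hz.
have hFG := mob_denom_neq0 (mob_comp F G) hz.
move: hG hFG; rewrite /mob_fun /= !rmorphD !rmorphM/= !conjCK.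
set a := mob_a F; set b := mob_b F; set c := mob_a G; set d := mob_b G.
move=> hG hFG.
have -> : a * ((c * z + d) / (d^* * z + c^*)) + b =
    ((a * c + b * d^*) * z + (a * d + b * c^*)) / (d^* * z + c^*).
  by field.
have -> : b^* * ((c * z + d) / (d^* * z + c^*)) + a^* =
    ((a^* * d^* + b^* * c) * z + (a^* * c^* + b^* * d)) / (d^* * z + c^*).
  by field.
by rewrite invf_div mulrA divfK.
Qed.

Lemma mob_act_id (x : circle) : mob_act mob_id x = x.
Proof.
apply: val_inj; rewrite /= /mob_fun/=.
by rewrite conjC0 conjC1 mul1r mul0r addr0 add0r divr1.
Qed.

Lemma mob_actM (F G : mobius) (x : circle) :
  mob_act (mob_comp F G) x = mob_act F (mob_act G x).
Proof. by apply: val_inj; rewrite /= mob_funM// circleP. Qed.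

Lemma mob_eq (F G : mobius) :
  mob_a F = mob_a G -> mob_b F = mob_b G -> F = G.
Proof.
case: F G => [a b hF] [c d hG] /= ac bd; subst c d.
by rewrite (Prop_irrelevance hF hG).
Qed.

Lemma mob_mulVF (F : mobius) : mob_comp (mob_inv F) F = mob_id.
Proof.
case: F => a b h; apply: mob_eq => /=.
  by rewrite mulNr -h !normCK mulrC.
by rewrite mulNr mulrC [b * _]mulrC subrr.
Qed.

Lemma mob_mulFV (F : mobius) : mob_comp F (mob_inv F) = mob_id.
Proof.
case: F => a b h; apply: mob_eq => /=.
  by rewrite rmorphN/= mulrN -h !normCK.
by rewrite conjCK mulrN mulrC addNr.
Qed.

Lemma mob_actK (F : mobius) : cancel (mob_act F) (mob_act (mob_inv F)).
Proof. by move=> x; rewrite -mob_actM mob_mulVF mob_act_id. Qed.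

Lemma mob_actVK (F : mobius) : cancel (mob_act (mob_inv F)) (mob_act F).
Proof. by move=> x; rewrite -mob_actM mob_mulFV mob_act_id. Qed.

(* F^{bullet}(x) = |F'(x)|, with F' the complex derivative *)
Definition expansion_rate (F : mobius) (x : circle) : C :=
  `|(mob_fun F)^`()%classic (cval x)|.

Definition expansion_interval_inv (F : mobius) : set circle :=
  [set x | 1 < expansion_rate (mob_inv F) x].

Definition represents (G : nat -> mobius) (x : circle) : Prop :=
  weak_star_cvg (fun n => pushforward circle_measure (mob_act (G n))) (\d_x).

End Mobius.

(* A^omega *)
Definition infword (A : finType) : Type :=
  prod_topology (fun _ : nat => discrete_topology A).

HB.instance Definition _ (A : finType) :=
  Topological.copy (infword A) (prod_topology (fun _ : nat => discrete_topology A)).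
HB.instance Definition _ (A : finType) :=
  Uniform.copy (infword A) (prod_topology (fun _ : nat => discrete_topology A)).

Section Words.
Variable A : finType.

Definition shift (w : infword A) : infword A := fun i => w i.+1.

Definition prefix_word (w : infword A) (n : nat) : seq A := mkseq w n.

Definition subshift (S : set (infword A)) : Prop :=
  closed S /\ shift @` S `<=` S.

Variable R : realType.
Variable F : A -> mobius R.

Definition mob_word (v : seq A) : mobius R :=
  foldr (fun a G => mob_comp (F a) G) (mob_id R) v.

Lemma mob_act_word (v : seq A) (x : circle R) :
  mob_act (mob_word v) x = foldr (fun a => mob_act (F a)) x v.
Proof.
by elim: v => [|a v IH] /=; rewrite ?mob_act_id ?mob_actM ?IH.
Qed.

Definition represents_word (w : infword A) (x : circle R) : Prop :=
  represents (fun n => mob_word (prefix_word w n.+1)) x.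

(* Phi is a partial map: Phi w is meaningful only when Phi_defined w. *)
Definition Phi_defined (w : infword A) : Prop :=
  exists x, represents_word w x.

Definition Phi (w : infword A) : circle R := get (represents_word w).

Definition mobius_number_system (S : set (infword A)) : Prop :=
  [/\ subshift S,
      S `<=` Phi_defined,
      Phi @` S = [set: circle R] &
      {within S, continuous Phi}].

End Words.

(* Main.v *)
Require Import Defs.
From HB Require Import structures.
From mathcomp Require Import all_boot all_order all_algebra.
From mathcomp Require Import all_classical all_reals all_analysis.
From mathcomp Require Import measurable_realfun ring lra.
From mathcomp.real_closed Require Import complex.

(** Two facts carry the proof: a criterion for convergence in terms of one real
number, and a mechanism that drives this number to infinity along products of
the F_b.

For a Möbius transformation G with coefficients a, b put
[closeness G x = |a|^2 * |(G^-1)'(x)|]. It equals [|x - G(0)|^-2], so it tends to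
infinity along G_n if and only if G_n(0) tends to x; and then G_n sends all of
the circle, except a short arc, close to x, so that the images of the uniform
measure tend to the Dirac measure at x ([represents_of_closeness]).

The subshift is made of the concatenations of words b_0, b_1, ... of B for which
the open arcs V_{b_0}, F_{b_0} V_{b_1}, F_{b_0 b_1} V_{b_2}, ... have, for every
n, a common point among the first n. The represented point x is then a point in
the closure of all these finite intersections, so the derivative at x of each of
the successive inverse maps is at least 1. If the product of these derivatives
is unbounded, closeness tends to infinity. Otherwise the derivatives tend to 1
and the orbit of x approaches the endpoints of the arcs V_b; there a second
quantity takes over, the twist, which is half the angular derivative of
log |F'|. Rate |F'| and twist compose like affine maps, they determine |b|
([normsq_b]), and the twist is bounded away from 0 near a point where the rate
is 1. Near such a neutral point a map expands on one side only, the side given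
by the sign of the twist; since nonempty open intersections accumulate at x, two
consecutive almost neutral steps must have twists of the same sign
([neutral_pair]; compactness and the finiteness of B make this uniform in
[neutral_pair_uniform]). Hence the twists add up without cancellation and
diverge, as they do for the powers of a parabolic map
([affine_recursion_growth], [product_closeness]). This is where covering by the
closures of the V_b suffices although the expansion at an endpoint is not strict,
and where openness of the intersected arcs is needed: with closed arcs, the words
b, b' with F_{b'} inverse to F_b could alternate forever.

To obtain a subshift over A, the words are read by an automaton whose states are
the positions in the words of B. The set [coding] of pairs (run, represented
point) is closed in a compact space. The subshift is its image under reading
letters, and [Phi] is induced by its other projection; this gives at once that
the subshift and its image under [Phi] are closed and that [Phi] is continuous.
The image is everything because it is dense: the closures of the V_b cover the
circle, so inside any nonempty open set a run can be prolonged forever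
([coding_dense]). *)

Set Implicit Arguments.
Unset Strict Implicit.
Unset Printing Implicit Defensive.

Import Order.TTheory GRing.Theory Num.Theory.
Import numFieldNormedType.Exports.

Local Open Scope classical_set_scope.
Local Open Scope ring_scope.

(** * Real coordinates on the complex numbers *)

Section ComplexNumbers.
Variable R : realType.
Local Notation C := (C R).

Definition toC (r : R) : C := (r%:C)%C.
Definition re (z : C) : R := complex.Re z.
Definition im (z : C) : R := complex.Im z.
Definition normsq (z : C) : R := re z ^+ 2 + im z ^+ 2.

Lemma toC_inj : injective toC. Proof. by move=> x y []. Qed.
Lemma toCD x y : toC (x + y) = toC x + toC y. Proof. exact: (rmorphD (real_complex R)). Qed.
Lemma toCM x y : toC (x * y) = toC x * toC y. Proof. exact: (rmorphM (real_complex R)). Qed.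
Lemma toC1 : toC 1 = 1. Proof. by []. Qed.
Lemma toC0 : toC 0 = 0. Proof. by []. Qed.
Lemma toCV x : toC x^-1 = (toC x)^-1. Proof. exact: (fmorphV (real_complex R)). Qed.
Lemma le_toC x y : (toC x <= toC y) = (x <= y). Proof. exact: lecR. Qed.
Lemma lt_toC x y : (toC x < toC y) = (x < y). Proof. exact: ltcR. Qed.

Lemma toC_normsq z : toC (normsq z) = z * z^*.
Proof. by rewrite /toC /normsq /re /im add_Re2_Im2 normCK. Qed.

Lemma toC_re z : toC (2 * re z) = z + z^*.
Proof.
case: z => a b; apply/eqP; rewrite eq_complex /= mulr_natl mulr2n.
by rewrite subrr !eqxx.
Qed.

Lemma normsq_ge0 z : 0 <= normsq z.
Proof. by rewrite addr_ge0 ?sqr_ge0. Qed.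

Lemma normsqM z w : normsq (z * w) = normsq z * normsq w.
Proof. by apply: toC_inj; rewrite toCM !toC_normsq rmorphM /= mulrACA. Qed.

Lemma normsqV z : normsq z^-1 = (normsq z)^-1.
Proof. by apply: toC_inj; rewrite toCV !toC_normsq fmorphV invfM. Qed.

Lemma normsq_conj z : normsq (z^*) = normsq z.
Proof. by apply: toC_inj; rewrite !toC_normsq conjCK mulrC. Qed.

Lemma normsqN z : normsq (- z) = normsq z.
Proof. by apply: toC_inj; rewrite !toC_normsq rmorphN mulrNN. Qed.

Lemma normsq_eq0 z : (normsq z == 0) = (z == 0).
Proof.
by rewrite -(inj_eq toC_inj) toC0 toC_normsq mulf_eq0 conjC_eq0 orbb.
Qed.

Lemma normsq_gt0 z : (0 < normsq z) = (z != 0).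
Proof. by rewrite lt_def normsq_eq0 normsq_ge0 andbT. Qed.

Lemma toC_normsq_norm z : toC (normsq z) = `|z| ^+ 2.
Proof. by rewrite toC_normsq normCK. Qed.

End ComplexNumbers.

Lemma cvg_linear (K : numFieldType) (T : Type) (F : set_system T)
  {FF : Filter F} (f : T -> K) (l c d : K) :
  f @ F --> l -> c * f z + d @[z --> F] --> c * l + d.
Proof.
move=> fl; apply: cvgD; last exact: cvg_cst.
by apply: cvgM => //; exact: cvg_cst.
Qed.

(** The difference quotient is exactly
    [((c (h + u) + d) (c u + d))^-1], because the determinant is 1. *)
Lemma derive_linear_frac (K : numFieldType) (a b c d u : K) :
  a * d - b * c = 1 -> c * u + d != 0 ->
  (fun z => (a * z + b) / (c * z + d))^`()%classic u = (c * u + d) ^- 2.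
Proof.
move=> e hu.
have den : c * (h + u) + d @[h --> (0 : K)] --> c * u + d.
  rewrite -[in X in _ --> X](add0r u).
  apply: (@cvg_linear K K (nbhs (0 : K)) _).
  have := @cvg_linear K K (nbhs (0 : K)) (nbhs_filter (0 : K)) id 0 1 u cvg_id.
  by rewrite mul1r; under eq_fun do rewrite mul1r.
have den0 : \forall h \near (0 : K), c * (h + u) + d != 0.
  move/cvgrPdist_lt : (den) => /(_ `|c * u + d|); rewrite normr_gt0 => /(_ hu).
  by apply: filterS => h; apply: contraTneq => ->; rewrite subr0 ltxx.
rewrite /derive1; apply: cvg_lim => //.
apply: (@cvg_trans _
  ((fun h : K => ((c * (h + u) + d) * (c * u + d))^-1) @ (0 : K)^')).
  apply: near_eq_cvg.
  apply: filterS2 (nbhs_dnbhs_neq _) (nbhs_dnbhs den0) => h h0 hd.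
  rewrite /= /GRing.scale /=.
  transitivity ((a * d - b * c) / ((c * (h + u) + d) * (c * u + d))).
    by rewrite e mul1r.
  by field; rewrite h0 hd hu.
rewrite -exprVn expr2 -invfM.
apply: cvgV; first by rewrite mulf_neq0.
apply: cvgM; last exact: cvg_cst.
exact: cvg_trans (cvg_app _ (cvg_within _)) den.
Qed.

(** * Rate and twist of a Möbius transformation *)

Section Automorphy.
Variable R : realType.
Local Notation C := (C R).
Local Notation mobius := (mobius R).
Local Notation circle := (circle R).
Implicit Types (F G : mobius) (x y z : circle).

Lemma cval_conj x : (cval x)^* = (cval x)^-1.
Proof.
have h := circleP x; have x0 : cval x != 0 by rewrite -normr_eq0 h oner_eq0.
by apply: (mulfI x0); rewrite -normCK h expr1n mulfV.
Qed.

Lemma cval_neq0 x : cval x != 0.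
Proof. by rewrite -normr_eq0 circleP oner_eq0. Qed.

Lemma normsq_cval x : normsq (cval x) = 1.
Proof. by apply: toC_inj; rewrite toC_normsq_norm circleP expr1n. Qed.

Definition jac F x : C := (mob_b F)^* * cval x + (mob_a F)^*.

(** The number [u j'(u) / j(u)] for j the factor of automorphy [jac] and
    u = [cval x]. Since [rate] and [twist] are read off its real and imaginary
    parts, their composition laws become the single identity [logder_comp]. *)
Definition logder F x : C := cval x * (mob_b F)^* / jac F x.

Definition rate F x : R := 1 - 2 * re (logder F x).

(** Half the derivative of [log (rate F)] with respect to the angle. *)
Definition twist F x : R := im (logder F x).

Lemma jac_neq0 F x : jac F x != 0.
Proof. by apply: mob_denom_neq0; rewrite circleP. Qed.

Lemma jac_conj F x : (jac F x)^* = mob_b F / cval x + mob_a F.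
Proof. by rewrite /jac rmorphD rmorphM /= !conjCK cval_conj. Qed.

Lemma mob_detC F : mob_a F * (mob_a F)^* - mob_b F * (mob_b F)^* = 1.
Proof. by rewrite -!normCK mobP. Qed.

(** After clearing denominators the left-hand side is
    [|a|^2 - |b|^2 = 1] over [|jac F x|^2]. *)
Lemma rateE F x : rate F x = (normsq (jac F x))^-1.
Proof.
apply: toC_inj; rewrite toCV toC_normsq.
have -> : toC (rate F x) = 1 - (logder F x + (logder F x)^*).
  rewrite -toC_re; exact: (rmorphB (real_complex R)).
have := jac_neq0 F x; have := jac_neq0 F x; rewrite -{1}conjC_eq0.
rewrite /logder fmorph_div /= rmorphM /= conjCK cval_conj jac_conj /jac.
have := cval_neq0 x; have := mob_detC F.
set a := mob_a F; set b := mob_b F; set u := cval x.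
set a' := a^*; set b' := b^*.
move=> e u0 j'0 j0.
transitivity ((a * a' - b * b') / ((b' * u + a') * (b / u + a)));
  last by rewrite e mul1r.
field.
apply/and3P; split=> //.
by apply: contra_neq j'0 => h; apply: (mulIf u0); rewrite mul0r -h; field.
Qed.

Lemma rate_gt0 F x : 0 < rate F x.
Proof. by rewrite rateE invr_gt0 normsq_gt0 jac_neq0. Qed.

Lemma cval_mob_act F x :
  cval (mob_act F x) = (mob_a F * cval x + mob_b F) / jac F x.
Proof. by []. Qed.

Lemma jac_comp F G x :
  jac (mob_comp F G) x = jac F (mob_act G x) * jac G x.
Proof.
have := jac_neq0 G x.
rewrite {1 3}/jac cval_mob_act /jac /= !rmorphD !rmorphM /= !conjCK => h.
by field.
Qed.

Lemma rate_comp F G x :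
  rate (mob_comp F G) x = rate F (mob_act G x) * rate G x.
Proof. by rewrite !rateE jac_comp normsqM invfM. Qed.

Lemma cval_mob_act_jac F x :
  cval (mob_act F x) = cval x * (jac F x)^* / jac F x.
Proof.
rewrite cval_mob_act jac_conj; congr (_ / _); have := cval_neq0 x => x0.
by field.
Qed.

(** The logarithmic derivative of the chain rule [jac_comp]. The
    factor [rate G x] is [u G'(u) / G(u)], which is [|G'(u)|] because G preserves
    the circle. *)
Lemma logder_comp F G x :
  logder (mob_comp F G) x =
  logder F (mob_act G x) * toC (rate G x) + logder G x.
Proof.
have jG := jac_neq0 G x; have jF := jac_neq0 F (mob_act G x).
have jG' : (jac G x)^* != 0 by rewrite conjC_eq0.
have e : 1 + (mob_b G)^* * (mob_a G * cval x + mob_b G) = mob_a G * jac G x.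
  by rewrite -(mob_detC G) /jac; ring.
have h : (mob_b F)^* / jac G x + (mob_b G)^* * jac F (mob_act G x) =
    (mob_a F * mob_b G + mob_b F * (mob_a G)^*)^*.
  (* the determinant of G turns 1 + conj b (a u + b) into a * jac G *)
  transitivity ((mob_b F)^* *
      (1 + (mob_b G)^* * (mob_a G * cval x + mob_b G)) / jac G x +
      (mob_b G)^* * (mob_a F)^*).
    by rewrite {2}/jac cval_mob_act; field.
  by rewrite e rmorphD !rmorphM /= conjCK; field.
rewrite rateE toCV toC_normsq {1}/logder /= -h jac_comp.
rewrite /logder cval_mob_act_jac.
have u0 := cval_neq0 x; field.
by rewrite jG jG' jF.
Qed.

Lemma twist_comp F G x : twist (mob_comp F G) x =
  twist F (mob_act G x) * rate G x + twist G x.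
Proof.
rewrite /twist logder_comp; case: (logder F _) (logder G x) => [a b] [c d].
by rewrite /im /=; ring.
Qed.

(** The left-hand side is the squared modulus of [logder F x]. This is how
    a bound on the coefficients of F controls its twist, and conversely. *)
Lemma normsq_b F x :
  (rate F x - 1) ^+ 2 / 4 + twist F x ^+ 2 = normsq (mob_b F) * rate F x.
Proof.
have -> : normsq (mob_b F) * rate F x = normsq (logder F x).
  rewrite rateE /logder normsqM normsqM normsqV normsq_conj.
  by rewrite normsq_cval mul1r.
by rewrite /rate /twist /normsq; field.
Qed.

Lemma derive_mob_fun F x :
  (mob_fun F)^`()%classic (cval x) = (jac F x) ^- 2.
Proof.
apply: derive_linear_frac; last exact: jac_neq0.
by rewrite -(mob_detC F).
Qed.

Lemma expansion_rateE F x : expansion_rate F x = toC (rate F x).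
Proof.
rewrite /expansion_rate derive_mob_fun rateE toCV toC_normsq_norm.
by rewrite normfV normrX.
Qed.

Lemma expansion_interval_invE F :
  expansion_interval_inv F = [set x | 1 < rate (mob_inv F) x].
Proof.
apply/seteqP.
by split=> x /=; rewrite /expansion_interval_inv /= expansion_rateE -(toC1 R) lt_toC.
Qed.

Lemma mob_compA F G H : mob_comp F (mob_comp G H) = mob_comp (mob_comp F G) H.
Proof.
by apply: mob_eq; rewrite /= !rmorphD !rmorphM /= !conjCK; ring.
Qed.

Lemma mob_comp1 F : mob_comp F (mob_id R) = F.
Proof. by apply: mob_eq; rewrite /= ?conjC0 ?conjC1; ring. Qed.

Lemma mob_1comp F : mob_comp (mob_id R) F = F.
Proof. by apply: mob_eq; rewrite /= ?conjC0 ?conjC1; ring. Qed.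

Lemma mob_inv_comp F G : mob_inv (mob_comp F G) = mob_comp (mob_inv G) (mob_inv F).
Proof.
apply: mob_eq; rewrite /= ?rmorphD ?rmorphM /= ?rmorphN /= ?conjCK; ring.
Qed.

Lemma normsq_a F : normsq (mob_a F) = 1 + normsq (mob_b F).
Proof.
by apply: toC_inj; rewrite [RHS]toCD !toC_normsq -[toC 1]/(1 : C) -(mob_detC F) subrK.
Qed.

End Automorphy.

(** * Topology of the circle *)

Section CircleTopology.
Variable R : realType.
Local Notation C := (C R).
Local Notation mobius := (mobius R).
Local Notation circle := (circle R).
Implicit Types (F G : mobius) (x y : circle) (u v w : C).

Definition cdist (z w : C) : R := Num.sqrt (normsq (z - w)).

Lemma toC_cdist u v : toC (cdist u v) = `|u - v|.
Proof. by rewrite normc_def. Qed.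

Lemma cdistC u v : cdist u v = cdist v u.
Proof. by apply: toC_inj; rewrite !toC_cdist distrC. Qed.

Lemma cdist_ge0 u v : 0 <= cdist u v.
Proof. exact: sqrtr_ge0. Qed.

Lemma cdist_triangle w u v : cdist u v <= cdist u w + cdist w v.
Proof.
rewrite -le_toC toCD !toC_cdist.
exact: ler_distD.
Qed.

Lemma cdist_eq0 u v : cdist u v = 0 -> u = v.
Proof.
move=> h; apply/eqP; rewrite -subr_eq0 -normr_eq0 -toC_cdist h.
exact: eqxx.
Qed.

(** The subspace topology comes with balls whose radii are elements
    of C; real radii make the rest of the analysis take place in R. *)
Lemma nbhs_circleP x (U : set circle) : nbhs x U <->
  exists2 e : R, 0 < e & forall z, cdist (cval x) (cval z) < e -> U z.
Proof.
split.
  rewrite nbhsE => -[B [oB Bx] BU].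
  case: oB => V oV VB.
  have Vx : V (cval x) by have := Bx; rewrite -VB.
  have /nbhs_ballP[e /= e0 eV] : nbhs (cval x) V by exact: open_nbhs_nbhs.
  have eE : toC (re e) = e by apply: RRe_real; exact: gtr0_real.
  exists (re e); first by rewrite -lt_toC eE.
  move=> z; rewrite -lt_toC toC_cdist eE => xz.
  by apply: BU; rewrite -VB; apply: eV.
move=> [e e0 eU].
have sub : @cval R @^-1` ball (cval x) (toC e) `<=` U.
  by move=> z /= xz; apply: eU; rewrite -lt_toC toC_cdist.
have e0' : (0 : C) < toC e by rewrite -[0]/(toC 0) lt_toC.
rewrite nbhsE; exists (@cval R @^-1` (ball (cval x) (toC e))°) => /=.
  split; last by exact: nbhsx_ballx.
  by exists (ball (cval x) (toC e))°; first exact: open_interior.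
by move=> z /interior_subset; exact: sub.
Qed.

Lemma continuous_re : continuous (fun x => re (cval x)).
Proof.
move=> x; apply/(@cvgrPdist_lt _ _ _ (nbhs x) (nbhs_filter x)) => e e0.
apply/nbhs_circleP; exists e => // z.
apply: le_lt_trans; rewrite -lecR.
have := normc_ge_Re (cval x - cval z); rewrite -toC_cdist.
by rewrite raddfB.
Qed.

Lemma continuous_im : continuous (fun x => im (cval x)).
Proof.
move=> x; apply/(@cvgrPdist_lt _ _ _ (nbhs x) (nbhs_filter x)) => e e0.
apply/nbhs_circleP; exists e => // z.
apply: le_lt_trans; rewrite /cdist -sqrtr_sqr ler_wsqrtr // /normsq /im raddfB /=.
by rewrite lerDr sqr_ge0.
Qed.

Lemma hausdorff_circle : hausdorff_space circle.
Proof.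
move=> x y xy; apply: val_inj; apply: cdist_eq0; apply/eqP.
rewrite eq_le cdist_ge0 andbT leNgt; apply/negP => d0.
have d2 : 0 < cdist (cval x) (cval y) / 2 by rewrite divr_gt0.
have [] := xy [set z | cdist (cval x) (cval z) < cdist (cval x) (cval y) / 2]
  [set z | cdist (cval y) (cval z) < cdist (cval x) (cval y) / 2].
- by apply/nbhs_circleP; exists (cdist (cval x) (cval y) / 2).
- by apply/nbhs_circleP; exists (cdist (cval x) (cval y) / 2).
move=> z [/= h1]; rewrite cdistC => h2.
have := cdist_triangle (cval z) (cval x) (cval y).
by rewrite leNgt [ltRHS](splitr (cdist (cval x) (cval y))) ltrD.
Qed.

Lemma reim_eta u : (re u +i* im u)%C = u. Proof. by case: u. Qed.

(** The angle is [acos] of the real part, or [2 pi] minus it, according to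
    the sign of the imaginary part. *)
Lemma turn_surj x : exists2 t : R, 0 <= t <= 1 & turn t = x.
Proof.
have h : re (cval x) ^+ 2 + im (cval x) ^+ 2 = 1 by exact: normsq_cval.
set c := re (cval x) in h; set s := im (cval x) in h.
have c1 : -1 <= c <= 1 by apply/andP; split; nra.
have ac : cos (acos c) = c by rewrite acosK.
have as_ : sin (acos c) = `|s|.
  by rewrite sin_acos // -h addrC addKr sqrtr_sqr.
have pi0 := @pi_gt0 R; have a0 := acos_ge0 c1; have api := acos_lepi c1.
have [s0|s0] := leP 0 s.
  exists (acos c / (2 * pi)).
    apply/andP; split; first by rewrite divr_ge0 // mulr_ge0 // ltW.
    by rewrite ler_pdivrMr ?mulr_gt0 // mul1r; lra.
  have -> : turn (acos c / (2 * pi)) = x; last by [].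
  apply: val_inj; rewrite /turn /= mulrC divfK ?mulf_neq0 ?gt_eqF //.
  by rewrite ac as_ ger0_norm //; exact: reim_eta.
exists (1 - acos c / (2 * pi)).
  have : 0 <= acos c / (2 * pi) <= 1.
    apply/andP; split; first by rewrite divr_ge0 // mulr_ge0 // ltW.
    by rewrite ler_pdivrMr ?mulr_gt0 // mul1r; lra.
  by lra.
apply: val_inj; rewrite /turn /=.
have -> : 2 * pi * (1 - acos c / (2 * pi)) = - acos c + pi *+ 2.
  have p0 : (pi : R) != 0 by rewrite gt_eqF.
  by move: (pi : R) (acos c) p0 => p a p0; rewrite -mulr_natl; field.
rewrite cosD2pi sinD2pi cosN sinN ac as_ ltr0_norm // opprK.
exact: reim_eta.
Qed.

Lemma compact_circle : compact [set: circle].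
Proof.
have -> : [set: circle] = @turn R @` `[0, 1].
  apply/seteqP; split=> // x _.
  have [t t01 <-] := turn_surj x; by exists t; rewrite //= in_itv.
apply: continuous_compact; last exact: segment_compact.
by apply: continuous_subspaceT; exact: continuous_turn.
Qed.

Lemma re_jac F x : re (jac F x) =
  re (mob_b F) * re (cval x) + im (mob_b F) * im (cval x) + re (mob_a F).
Proof.
rewrite /jac; case: (mob_a F) (mob_b F) (cval x) => [a1 a2] [b1 b2] [c s].
by rewrite /re /im /=; ring.
Qed.

Lemma im_jac F x : im (jac F x) =
  re (mob_b F) * im (cval x) - im (mob_b F) * re (cval x) - im (mob_a F).
Proof.
rewrite /jac; case: (mob_a F) (mob_b F) (cval x) => [a1 a2] [b1 b2] [c s].
by rewrite /re /im /=; ring.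
Qed.

Lemma continuous_rate F : continuous (rate F).
Proof.
move=> x; rewrite (_ : rate F = fun x => (normsq (jac F x))^-1); last first.
  by apply/funext => z; rewrite rateE.
apply: (@cvgV _ _ (nbhs x) (nbhs_filter x)).
  by rewrite gt_eqF // normsq_gt0 jac_neq0.
have c := @continuous_re x; have s := @continuous_im x.
have cst (T : R) : T @[_ --> nbhs x] --> T by exact: cvg_cst.
have FF := nbhs_filter x.
have c1 : re (jac F z) @[z --> nbhs x] --> re (jac F x).
  under eq_fun do rewrite re_jac; rewrite re_jac.
  by apply: (cvgD (cvgD (cvgM (cst _) c) (cvgM (cst _) s)) (cst _)).
have s1 : im (jac F z) @[z --> nbhs x] --> im (jac F x).
  under eq_fun do rewrite im_jac; rewrite im_jac.
  by apply: (cvgB (cvgB (cvgM (cst _) s) (cvgM (cst _) c)) (cst _)).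
exact: (cvgD (cvgM c1 c1) (cvgM s1 s1)).
Qed.

(** Multiplying numerator and denominator of [logder] by the conjugate of
    [jac] leaves a linear function of the point times the rate, hence
    continuity of [twist]. *)
Lemma twistE F x :
  twist F x = im (cval x * ((mob_b F)^* * mob_a F)) * rate F x.
Proof.
have j0 := jac_neq0 F x; have j0' : (jac F x)^* != 0 by rewrite conjC_eq0.
have e : logder F x =
    (toC (normsq (mob_b F)) + cval x * ((mob_b F)^* * mob_a F)) * toC (rate F x).
  rewrite rateE toCV !toC_normsq /logder.
  transitivity (cval x * (mob_b F)^* * (jac F x)^* / (jac F x * (jac F x)^*)).
    by field; rewrite j0 j0'.
  rewrite {1}jac_conj; congr (_ / _); have := cval_neq0 x => x0.
  by field.
rewrite /twist e; case: (cval x * _) => a b.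
by rewrite /im /=; ring.
Qed.

Lemma continuous_twist F : continuous (twist F).
Proof.
move=> x; rewrite (_ : twist F = fun x =>
  (re (cval x) * im ((mob_b F)^* * mob_a F) +
   im (cval x) * re ((mob_b F)^* * mob_a F)) * rate F x); last first.
  by apply/funext => z; rewrite twistE; case: (cval z) (_ * mob_a F) => [a b] [c d].
have FF := nbhs_filter x.
have c := @continuous_re x; have s := @continuous_im x.
have cst (T : R) : T @[_ --> nbhs x] --> T by exact: cvg_cst.
exact: (cvgM (cvgD (cvgM c (cst _)) (cvgM s (cst _))) (@continuous_rate F x)).
Qed.

End CircleTopology.

(** * Divergence of an affine recursion *)

Section AffineRecursion.
Variable R : realType.

(** The increments [nu k * D k] have constant sign and modulus at least
    [c * d]. *)
Lemma linear_drift (N nu D : nat -> R) (c d : R) (K : nat) : 0 < c -> 0 < d ->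
  (forall k, d <= D k) ->
  (forall k, N k.+1 = nu k * D k + N k) ->
  (forall k, (K <= k)%N -> c ^+ 2 <= nu k ^+ 2) ->
  (forall k, (K <= k)%N -> 0 < nu k * nu k.+1) ->
  0 < nu K ->
  forall M, \forall k \near \oo, M <= N k.
Proof.
move=> c0 d0 dD NS cnu sgn nuK M.
have pos m : 0 < nu (K + m)%N.
  elim: m => [|m IH]; first by rewrite addn0.
  by have := sgn _ (leq_addr m K); rewrite addnS pmulr_rgt0.
have low m : c <= nu (K + m)%N.
  have := cnu _ (leq_addr m K); rewrite ler_sqr // nnegrE ltW //; exact: pos.
have lin m : N K + c * d * m%:R <= N (K + m)%N.
  elim: m => [|m IH]; first by rewrite mulr0 addr0 addn0.
  rewrite addnS NS -natr1 mulrDr mulr1.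
  have : c * d <= nu (K + m)%N * D (K + m)%N by rewrite ler_pM // ?ltW // low.
  by move: IH; lra.
near=> k.
have Kk : (K <= k)%N by near: k; exact: nbhs_infty_ge.
have := lin (k - K)%N; rewrite subnKC //; apply: le_trans.
have kM : (M - N K) / (c * d) + K%:R <= k%:R by near: k; exact: nbhs_infty_ger.
rewrite -lerBlDl mulrC -ler_pdivrMr ?mulr_gt0 // natrB //.
by rewrite lerBrDr.
Unshelve. all: by end_near. Qed.

(** D and N are the rate and the twist of a product whose
    factors have rate [lam k] and twist [nu k]. Since D is nondecreasing, either
    it is unbounded and the term [(D - 1)^2] wins, or [lam] tends to 1; then the
    lower bound on [(lam - 1)^2 / 4 + nu^2] keeps [nu] away from 0, its sign is
    eventually constant, and N drifts linearly. *)
Lemma affine_recursion_growth (D N lam nu : nat -> R) (b eta : R) :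
  0 < b -> 0 < eta -> 0 < D 0%N ->
  (forall k, D k.+1 = lam k * D k) ->
  (forall k, N k.+1 = nu k * D k + N k) ->
  (forall k, 1 <= lam k) ->
  (forall k, b * lam k <= (lam k - 1) ^+ 2 / 4 + nu k ^+ 2) ->
  (forall k, lam k * lam k.+1 < 1 + eta -> 0 < nu k * nu k.+1) ->
  forall M, \forall k \near \oo, M * D k <= (D k - 1) ^+ 2 / 4 + N k ^+ 2.
Proof.
move=> b0 eta0 D00 DS NS lam1 bnu sgn M.
have Dpos k : 0 < D k.
  by elim: k => // k IH; rewrite DS mulr_gt0 // (lt_le_trans ltr01).
have Dinc : {homo D : n m / (n <= m)%N >-> n <= m}.
  by apply/nondecreasing_seqP => k; rewrite DS ler_peMl // ltW.
have [[K DK]|Dbd] := pselect (exists k, 4 * M + 2 <= D k).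
  near=> k.
  have Kk : (K <= k)%N by near: k; exact: nbhs_infty_ge.
  have h : 4 * M + 2 <= D k by apply: le_trans DK _; exact: Dinc.
  have := Dpos k; have := sqr_ge0 (N k); nra.
have {}Dbd k : D k < 4 * M + 2.
  by rewrite ltNge; apply/negP => h; apply: Dbd; exists k.
(* these bounds give (1 + th)^2 < 1 + eta and th^2 <= b *)
pose th : R := Num.min 1 (Num.min (eta / 4) b).
have th0 : 0 < th by rewrite !lt_min ltr01 b0 divr_gt0.
have th1 : th <= 1 by rewrite ge_min lexx.
have theta : th <= eta / 4 by rewrite !ge_min lexx orbT.
have thb : th <= b by rewrite !ge_min lexx !orbT.
have [K lamK] : exists K, forall k, (K <= k)%N -> lam k < 1 + th.
  have Dcvg : cvgn D.
    apply: nondecreasing_is_cvgn => //; exists (4 * M + 2) => _ [k _ <-].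
    exact: ltW.
  have e0 : 0 < th * D 0%N / 2 by rewrite divr_gt0 // mulr_gt0.
  move/cvgrPdist_lt : Dcvg => /(_ _ e0) [K _ HK].
  exists K => k Kk.
  have := HK _ Kk; have := HK k.+1 (leqW Kk) => /=.
  rewrite !ltr_norml => /andP[h1 h2] /andP[h3 h4].
  have : (lam k - 1) * D k < th * D 0%N by rewrite mulrBl mul1r -DS; lra.
  have := lam1 k; have := Dinc 0%N k (leq0n k); have := Dpos k; nra.
pose c := Num.sqrt (b / 2).
have c0 : 0 < c by rewrite sqrtr_gt0 divr_gt0.
have c2 : c ^+ 2 = b / 2 by rewrite sqr_sqrtr // divr_ge0 // ltW.
have cnu k : (K <= k)%N -> c ^+ 2 <= nu k ^+ 2.
  by move=> /lamK; rewrite c2; have := bnu k; have := lam1 k; nra.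
have sgn' k : (K <= k)%N -> 0 < nu k * nu k.+1.
  move=> Kk; apply: sgn; have := lamK _ Kk; have := lamK k.+1 (leqW Kk).
  have := lam1 k; have := lam1 k.+1; nra.
have M1 : 0 < 1 + 4 * M + 2.
  by have := Dbd 0%N; lra.
have D0 k : D 0%N <= D k by exact: Dinc.
have big : \forall k \near \oo, (1 + `|M| * (4 * M + 2)) <= `|N k|.
  have : nu K != 0.
    by have := sgn' K (leqnn K); apply: contraTneq => ->; rewrite mul0r ltxx.
  case/lt_total/orP => nuK.
    have h := @linear_drift (fun k => - N k) (fun k => - nu k) D c (D 0%N) K c0 D00 D0.
    have {h} := h _ _ _ _ (1 + `|M| * (4 * M + 2)).
    move=> h; apply: filterS (h _ _ _ _) => [k hk|k|k|k|].
    - by apply: le_trans hk _; rewrite -normrN ler_norm.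
    - by rewrite NS; ring.
    - by rewrite sqrrN; exact: cnu.
    - by rewrite mulrNN; exact: sgn'.
    - by rewrite oppr_gt0.
  apply: filterS (linear_drift c0 D00 D0 NS cnu sgn' nuK (1 + `|M| * (4 * M + 2))).
  by move=> k hk; apply: le_trans hk _; rewrite ler_norm.
apply: filterS big => k hk.
have := Dpos k; have := Dbd k; have := ler_norm M; have := normr_ge0 M.
have := sqr_ge0 (D k - 1); rewrite -(real_normK (num_real (N k))).
move: hk; set m := `|M|; set n := `|N k| => h1 h2 h3 h4 h5 h6.
have : M * D k <= m * (4 * M + 2) by nra.
nra.
Unshelve. all: by end_near. Qed.

End AffineRecursion.

(** * Expansion near a neutral point is one-sided *)

Section OneSidedExpansion.
Variable R : realType.
Local Notation C := (C R).
Local Notation mobius := (mobius R).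
Local Notation circle := (circle R).
Implicit Types (F G : mobius) (x y z : circle).

Definition quot z y : C := cval z / cval y.

Lemma normsq_quot z y : re (quot z y) ^+ 2 + im (quot z y) ^+ 2 = 1.
Proof.
rewrite -/(normsq _) /quot normsqM normsqV.
by rewrite !normsq_cval invr1 mulr1.
Qed.

(** [jac F] is affine, so it is determined by its value and its logarithmic
    derivative at y. *)
Lemma jac_quot F y z :
  jac F z = jac F y * (1 + logder F y * (quot z y - 1)).
Proof.
have := jac_neq0 F y; have := cval_neq0 y.
by rewrite /logder /quot {1 2}/jac => y0 j0; rewrite /jac in j0 *; field; rewrite y0 j0.
Qed.

Lemma neutral_logder F y : rate F y = 1 -> re (logder F y) = 0.
Proof. by rewrite /rate; lra. Qed.

(** When [rate F y = 1] the number [logder F y] is purely imaginary,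
    and [quot z y] lies on the unit circle; expand the square. *)
Lemma neutral_jac_ratio F y z : rate F y = 1 ->
  normsq (1 + logder F y * (quot z y - 1)) =
  1 - 2 * twist F y * im (quot z y) + 2 * twist F y ^+ 2 * (1 - re (quot z y)).
Proof.
move=> /neutral_logder; rewrite /twist; have := normsq_quot z y.
case: (quot z y) (logder F y) => [c s] [p n].
rewrite /normsq /re /im /= => cs p0; rewrite p0; nra.
Qed.

(** By [neutral_jac_ratio] expansion at z reads
    [nu * s > nu^2 * (1 - c)] with [quot z y = c + i s], and [1 - c] is
    nonnegative. The conclusion holds for every z, not only near y. *)
Lemma expansion_side F y z : rate F y = 1 -> 1 < rate F z ->
  0 < twist F y * im (quot z y).
Proof.
move=> y1; rewrite rateE (jac_quot F y) normsqM.
have -> : normsq (jac F y) = 1 by have := y1; rewrite rateE => /eqP; rewrite invr_eq1 => /eqP.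
rewrite mul1r invf_gt1; last first.
  rewrite normsq_gt0; apply/eqP => h; have := jac_neq0 F z.
  by rewrite (jac_quot F y) h mulr0 eqxx.
rewrite neutral_jac_ratio //; have := normsq_quot z y.
set c := re _; set s := im _ => cs.
have c1 : 0 <= 1 - c by nra.
have := mulr_ge0 (sqr_ge0 (twist F y)) c1; lra.
Qed.

(** The determinant is 1, so the cross terms in the numerator leave
    [z - y]. *)
Lemma mob_act_diff F y z : cval (mob_act F z) - cval (mob_act F y) =
  (cval z - cval y) / (jac F z * jac F y).
Proof.
have := jac_neq0 F y; have := jac_neq0 F z; rewrite !cval_mob_act.
move=> jz jy; rewrite -[cval z - cval y]mul1r -(mob_detC F).
rewrite /jac in jz jy *; field; by rewrite jz jy.
Qed.

Lemma im_div (u v : C) : v != 0 -> im (u / v) * normsq v = im (u * v^*).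
Proof.
move=> v0; have -> : u * v^* = u / v * toC (normsq v).
  by rewrite toC_normsq mulrA divfK.
by case: (u / v) => a b; rewrite /im /=; ring.
Qed.

Lemma re_quot z y :
  re (quot z y) = re (cval z) * re (cval y) + im (cval z) * im (cval y).
Proof.
rewrite /quot -cval_conj; case: (cval z) (cval y) => [a b] [c d].
by rewrite /re /im /=; ring.
Qed.

Lemma im_quot z y :
  im (quot z y) = im (cval z) * re (cval y) - re (cval z) * im (cval y).
Proof.
rewrite /quot -cval_conj; case: (cval z) (cval y) => [a b] [c d].
by rewrite /re /im /=; ring.
Qed.

(** Dividing [mob_act_diff] by [mob_act F y] gives
    [quot (F z) (F y) - 1 = d / (1 + logder F y * d)] with [d = quot z y - 1];
    take imaginary parts. *)
Lemma quot_mob_act F y z : rate F y = 1 ->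
  im (quot (mob_act F z) (mob_act F y)) *
    normsq (1 + logder F y * (quot z y - 1)) =
  im (quot z y) - 2 * twist F y * (1 - re (quot z y)).
Proof.
move=> y1.
have jy : normsq (jac F y) = 1 by have := y1; rewrite rateE => /eqP; rewrite invr_eq1 => /eqP.
have d0 : 1 + logder F y * (quot z y - 1) != 0.
  apply/eqP => h; have := jac_neq0 F z.
  by rewrite (jac_quot F y) h mulr0 eqxx.
have e : quot (mob_act F z) (mob_act F y) - 1 =
    (quot z y - 1) / (1 + logder F y * (quot z y - 1)).
  have jj : jac F y * (jac F y)^* = 1 by rewrite -toC_normsq jy.
  have j0 := jac_neq0 F y.
  have j0' : (jac F y)^* != 0 by rewrite conjC_eq0.
  have jz0 := jac_neq0 F z.
  have y0 := cval_neq0 y.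
  have -> : 1 + logder F y * (quot z y - 1) = jac F z / jac F y.
    by rewrite [in RHS](jac_quot F y z) [RHS]mulrAC mulfV // mul1r.
  have -> : quot (mob_act F z) (mob_act F y) - 1 =
     (cval (mob_act F z) - cval (mob_act F y)) / cval (mob_act F y).
    by rewrite /quot; have := cval_neq0 (mob_act F y) => h0; field.
  rewrite mob_act_diff cval_mob_act_jac /quot.
  transitivity ((cval z - cval y) / (cval y * jac F z * (jac F y)^*)).
    by field; rewrite y0 jz0 j0 j0'.
  rewrite -[LHS]mulr1 -[X in _ * X = _]jj; field.
  by rewrite y0 jz0 j0 j0'.
have -> : im (quot (mob_act F z) (mob_act F y)) =
    im (quot (mob_act F z) (mob_act F y) - 1).
  by case: (quot (mob_act F z) _) => a b; rewrite /im /= subr0.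
rewrite e im_div //; have := neutral_logder y1; have := normsq_quot z y.
rewrite /twist; case: (quot z y) (logder F y) => [c s] [p n].
rewrite /re /im /= => cs p0; rewrite p0.
transitivity (s - n * (c ^+ 2 + s ^+ 2 - 2 * c + 1)); first by ring.
by rewrite cs; ring.
Qed.

(** F preserves orientation; the two inequalities on z specify how
    near to y it has to be for the sign of the sine of the angle between z and y
    to be preserved. *)
Lemma neutral_orientation F y z : rate F y = 1 -> 0 < re (quot z y) ->
  `|2 * twist F y * im (quot z y)| <= 1 ->
  0 <= im (quot z y) * im (quot (mob_act F z) (mob_act F y)).
Proof.
move=> y1 c0 s1.
have d0 : 0 < normsq (1 + logder F y * (quot z y - 1)).
  rewrite normsq_gt0; apply/eqP => h; have := jac_neq0 F z.
  by rewrite (jac_quot F y) h mulr0 eqxx.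
rewrite -(pmulr_lge0 _ d0) -mulrA quot_mob_act //.
have := normsq_quot z y; move: s1; rewrite ler_norml => /andP[].
move: c0; set c := re _; set s := im _; set n := twist F y => c0 h1 h2 cs.
have c1 : 0 <= 1 - c by nra.
have cs2 : 1 - c <= s ^+ 2 by nra.
have : 2 * n * s * (1 - c) <= 1 - c by nra.
nra.
Qed.

(** A point z near y with both rates above 1 lies on the side of y given by
    the twist of F, and [mob_act F z] lies on the side of [mob_act F y] given by
    the twist of G. As F preserves orientation near y, the two sides agree. *)
Lemma neutral_pair F G y : rate F y = 1 -> rate G (mob_act F y) = 1 ->
  closure [set z | 1 < rate F z /\ 1 < rate G (mob_act F z)] y ->
  0 < twist F y * twist G (mob_act F y).
Proof.
move=> y1 y2 cly.
have FF := nbhs_filter y.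
have c := @continuous_re R y; have s := @continuous_im R y.
have cst (T : R) : T @[_ --> nbhs y] --> T by exact: cvg_cst.
have q1 : quot y y = 1 by rewrite /quot mulfV // cval_neq0.
have re1 : re (quot z y) @[z --> nbhs y] --> re (quot y y).
  under eq_fun do rewrite re_quot; rewrite re_quot.
  exact: (cvgD (cvgM c (cst _)) (cvgM s (cst _))).
have im0 : 2 * twist F y * im (quot z y) @[z --> nbhs y] -->
    2 * twist F y * im (quot y y).
  apply: cvgM; first exact: cst.
  under eq_fun do rewrite im_quot; rewrite im_quot.
  exact: (cvgB (cvgM s (cst _)) (cvgM c (cst _))).
have [z [[z1 z2] [c0 s1]]] : [set z | 1 < rate F z /\ 1 < rate G (mob_act F z)] `&`
   [set z | 0 < re (quot z y) /\ `|2 * twist F y * im (quot z y)| <= 1] !=set0.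
  apply: cly; apply: filterI.
    by apply: (@cvgr_gt _ _ (nbhs y) FF _ _ re1); rewrite q1 ltr01.
  have := @cvgr_dist_lt _ _ _ (nbhs y) FF _ _ im0 1 ltr01.
  apply: (@filterS _ (nbhs y) FF) => z; rewrite q1 /= mulr0 sub0r normrN.
  exact: ltW.
have h1 := expansion_side y1 z1.
have h2 := expansion_side y2 z2.
have h3 := neutral_orientation y1 c0 s1.
nra.
Qed.

End OneSidedExpansion.

(** * Infinite products of Möbius transformations *)

Section InfiniteProducts.
Variable R : realType.

(** Used to make constants uniform over the finitely many factors
    that occur in a product. *)
Lemma finite_pos_lower_bound (I : finType) (f : I -> R) :
  (forall i, 0 < f i) -> exists2 b : R, 0 < b & forall i, b <= f i.
Proof.
move=> f0; exists (\big[Num.min/1]_i f i); last by move=> i; exact: bigmin_le.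
by elim/big_ind: _ => // u v u0 v0; rewrite lt_min u0.
Qed.

Local Notation C := (C R).
Local Notation mobius := (mobius R).
Local Notation circle := (circle R).
Implicit Types (F G P : mobius) (x y z : circle).

Lemma closure_ge (f : circle -> R) (a : R) (S : set circle) x :
  continuous f -> (forall y, S y -> a <= f y) -> closure S x -> a <= f x.
Proof.
move=> cf Sa clx.
have cl : closed (f @^-1` [set r | a <= r]).
  by apply: closed_comp => [y _|]; [exact: cf|exact: closed_ge].
by apply: (cl x); apply: closure_subset clx => y; exact: Sa.
Qed.

(** The points of the closure where the product of the twists is
    at most 0 form a compact set, on which the product of the rates is at least 1
    and, by [neutral_pair], never equal to 1. *)
Lemma neutral_pair_uniform F G : exists2 eta : R, 0 < eta & forall y,
  closure [set z | 1 < rate F z /\ 1 < rate G (mob_act F z)] y ->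
  rate F y * rate G (mob_act F y) < 1 + eta ->
  0 < twist F y * twist G (mob_act F y).
Proof.
set W := [set z | _].
have comp_cont (f : circle -> R) : continuous f -> continuous (fun z => f (mob_act F z)).
  move=> cf z; apply: (@continuous_comp _ _ _ (mob_act F) f z).
    exact: continuous_mob_act.
  exact: cf.
have ctw : continuous (fun z => twist F z * twist G (mob_act F z)).
  move=> z; have FF := nbhs_filter z; apply: cvgM; first exact: continuous_twist.
  exact: (comp_cont _ (@continuous_twist _ G)).
have crt : continuous (fun z => rate F z * rate G (mob_act F z)).
  move=> z; have FF := nbhs_filter z; apply: cvgM; first exact: continuous_rate.
  exact: (comp_cont _ (@continuous_rate _ G)).
have ge1 y : closure W y -> 1 <= rate F y.
  by apply: closure_ge; [exact: continuous_rate|move=> z [/ltW]].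
have ge2 y : closure W y -> 1 <= rate G (mob_act F y).
  move=> h; apply: (closure_ge (comp_cont _ (@continuous_rate _ G)) _ h).
  by move=> z [_ /ltW].
pose K := closure W `&` [set y | twist F y * twist G (mob_act F y) <= 0].
have cK : compact K.
  apply: (subclosed_compact _ (@compact_circle R)) => //.
  apply: closedI; first exact: closed_closure.
  have : closed ((fun z => twist F z * twist G (mob_act F z)) @^-1` [set r | r <= 0]).
    by apply: closed_comp => [y _|]; [exact: ctw|exact: closed_le].
  by [].
(* L is closed and misses 1, hence misses a neighbourhood of 1 *)
pose L := (fun z => rate F z * rate G (mob_act F z)) @` K.
have cL : closed L.
  apply: compact_closed; first exact: Rhausdorff.
  apply: continuous_compact => //; exact: continuous_subspaceT.
have L1 : nbhs (1 : R) (~` L).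
  apply: open_nbhs_nbhs; split; first exact: closed_openC.
  move=> [y [cly tw0] /= e].
  have h1 := ge1 _ cly; have h2 := ge2 _ cly.
  have e1 : rate F y = 1 by nra.
  have e2 : rate G (mob_act F y) = 1 by nra.
  by have := neutral_pair e1 e2 cly; rewrite ltNge tw0.
move/nbhs_ballP : L1 => [eta /= eta0 ball_eta].
exists eta => // y cly ylt; rewrite ltNge; apply/negP => tw0.
apply: (ball_eta (rate F y * rate G (mob_act F y))); last by exists y.
have h1 := ge1 _ cly; have h2 := ge2 _ cly.
by rewrite /ball /= ltr_norml; apply/andP; split; nra.
Qed.

(** By [closeness_dist] this is [|x - G(0)|^-2]; the product form is the one
    that can be estimated along compositions. *)
Definition closeness G x : R := normsq (mob_a G) * rate (mob_inv G) x.

(** [x - G(0)] has the modulus of [jac (mob_inv G) x / a]. *)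
Lemma closeness_dist G x : normsq (cval x - mob_fun G 0) = (closeness G x)^-1.
Proof.
have a0 : (mob_a G)^* != 0.
  by rewrite conjC_eq0 -normsq_eq0 normsq_a gt_eqF // ltr_wpDr ?normsq_ge0.
rewrite /closeness rateE invfM invrK.
have -> : cval x - mob_fun G 0 = cval x * (jac (mob_inv G) x)^* / (mob_a G)^*.
  rewrite jac_conj /= /mob_fun !mulr0 !add0r; have := cval_neq0 x => x0.
  by field; rewrite x0 a0.
by rewrite 2!normsqM normsqV !normsq_conj normsq_cval mul1r mulrC.
Qed.

(** An upper bound for the square of the operator norm of the matrix of P. *)
Definition msize P : R := 2 * (normsq (mob_a P) + normsq (mob_b P)).

Lemma normsqD_le (u v : C) : normsq (u + v) <= 2 * (normsq u + normsq v).
Proof.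
case: u v => [a b] [c d]; rewrite /normsq /re /im /=.
have := sqr_ge0 (a - c); have := sqr_ge0 (b - d); nra.
Qed.

Lemma msize_gt0 P : 0 < msize P.
Proof.
by rewrite mulr_gt0 // normsq_a -addrA ltr_wpDr // addr_ge0 ?normsq_ge0.
Qed.

Lemma rate_msize P x : (msize P)^-1 <= rate (mob_inv P) x.
Proof.
rewrite rateE lef_pV2 ?posrE ?msize_gt0 ?normsq_gt0 ?jac_neq0 //.
apply: le_trans (normsqD_le _ _) _.
have -> : normsq ((mob_b (mob_inv P))^* * cval x) = normsq (mob_b P).
  by rewrite normsqM normsq_conj normsqN normsq_cval mulr1.
by rewrite /= conjCK addrC lexx.
Qed.

(** Changing G by a bounded factor on the right changes both [|a|^2]
    and the rate by a bounded factor. *)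
Lemma closeness_comp G P x : closeness G x / msize P ^+ 2 <= closeness (mob_comp G P) x.
Proof.
have mP := msize_gt0 P.
rewrite /closeness mob_inv_comp rate_comp.
set r := rate (mob_inv G) x; set s := rate (mob_inv P) _.
have r0 : 0 < r by exact: rate_gt0.
have sP : (msize P)^-1 <= s by exact: rate_msize.
have aP : normsq (mob_a G) <= normsq (mob_a (mob_comp G P)) * msize P.
  have -> : mob_a G = mob_a (mob_comp (mob_comp G P) (mob_inv P)).
    by rewrite -mob_compA mob_mulFV mob_comp1.
  apply: le_trans (normsqD_le _ _) _.
  rewrite !normsqM !normsq_conj normsqN /msize mulrCA ler_pM2l //.
  rewrite [leRHS]mulrDr lerD2l.
  by rewrite ler_wpM2r ?normsq_ge0 // normsq_a lerDr.
have : closeness G x / msize P ^+ 2 <= (normsq (mob_a (mob_comp G P)) * msize P) * r / msize P ^+ 2.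
  by rewrite ler_pM2r ?invr_gt0 ?exprn_gt0 // ler_pM2r.
move=> /le_trans; apply.
have -> : normsq (mob_a (mob_comp G P)) * msize P * r / msize P ^+ 2 =
   normsq (mob_a (mob_comp G P)) * ((msize P)^-1 * r).
  by field; rewrite gt_eqF.
by rewrite ler_wpM2l ?normsq_ge0 // ler_pM2r.
Qed.

Lemma normsq_b_inv G : normsq (mob_b (mob_inv G)) = normsq (mob_b G).
Proof. exact: normsqN. Qed.

(** The derivatives and twists at x of the inverses of the partial
    products satisfy the affine recursion of [affine_recursion_growth]. The
    factors are not rotations, since their expansion intervals are visited, so
    finiteness of I bounds their coefficients [b] away from 0; the sign condition
    on the twists is [neutral_pair_uniform], applied to the finitely many pairs
    of factors. *)
Theorem product_closeness (I : finType) (H : I -> mobius) (w : nat -> I)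
    (Gam : nat -> mobius) x :
  (forall k, Gam k.+1 = mob_comp (Gam k) (H (w k))) ->
  (forall n, closure [set y | forall k, (k <= n)%N ->
     expansion_interval_inv (H (w k)) (mob_act (mob_inv (Gam k)) y)] x) ->
  forall M, \forall k \near \oo, M <= closeness (Gam k) x.
Proof.
move=> GamS clx M.
pose Hi i := mob_inv (H i).
pose xk k := mob_act (mob_inv (Gam k)) x.
pose D k := rate (mob_inv (Gam k)) x.
pose N k := twist (mob_inv (Gam k)) x.
pose lam k := rate (Hi (w k)) (xk k).
pose nu k := twist (Hi (w k)) (xk k).
have xkS k : xk k.+1 = mob_act (Hi (w k)) (xk k).
  by rewrite /xk GamS mob_inv_comp mob_actM.
have DS k : D k.+1 = lam k * D k by rewrite /D GamS mob_inv_comp rate_comp.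
have NS k : N k.+1 = nu k * D k + N k.
  by rewrite /N GamS mob_inv_comp twist_comp.
have clk k : closure [set z | 1 < rate (Hi (w k)) z /\
    1 < rate (Hi (w k.+1)) (mob_act (Hi (w k)) z)] (xk k).
  move=> V /(@continuous_mob_act R (mob_inv (Gam k)) x) V'.
  have [y [yW yV]] := clx k.+1 _ V'.
  exists (mob_act (mob_inv (Gam k)) y); split => //.
  have := yW _ (leqnn k.+1); have := yW _ (leqnSn k).
  rewrite !expansion_interval_invE /= GamS mob_inv_comp mob_actM.
  by [].
have lam1 k : 1 <= lam k.
  have := clk k; apply: closure_ge; first exact: continuous_rate.
  by move=> z [/ltW].
have bpos k : 0 < normsq (mob_b (H (w k))).
  have [z [z1 _]] : [set z | 1 < rate (Hi (w k)) z /\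
    1 < rate (Hi (w k.+1)) (mob_act (Hi (w k)) z)] !=set0.
    by have [z [zW _]] := clk k setT filterT; exists z.
  have := normsq_b (Hi (w k)) z; rewrite normsq_b_inv.
  have := sqr_ge0 (twist (Hi (w k)) z); nra.
have [b b0 blow] : exists2 b : R, 0 < b & forall k, b <= normsq (mob_b (H (w k))).
  pose f i := if 0 < normsq (mob_b (H i)) then normsq (mob_b (H i)) else 1.
  have [|b b0 bf] := @finite_pos_lower_bound I f.
    by move=> i; rewrite /f; case: ifP.
  by exists b => // k; have := bf (w k); rewrite /f bpos.
have [eta eta0 etaP] : exists2 eta : R, 0 < eta & forall k,
    lam k * lam k.+1 < 1 + eta -> 0 < nu k * nu k.+1.
  have /choice[f fP] : forall p : I * I, exists e : R, 0 < e /\ forall y,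
      closure [set z | 1 < rate (Hi p.1) z /\ 1 < rate (Hi p.2) (mob_act (Hi p.1) z)] y ->
      rate (Hi p.1) y * rate (Hi p.2) (mob_act (Hi p.1) y) < 1 + e ->
      0 < twist (Hi p.1) y * twist (Hi p.2) (mob_act (Hi p.1) y).
    move=> p; have [e e0 eP] := neutral_pair_uniform (Hi p.1) (Hi p.2).
    by exists e.
  have [eta eta0 etaf] := finite_pos_lower_bound (fun p => (fP p).1).
  exists eta => // k h.
  have [_ /(_ _ (clk k))] := fP (w k, w k.+1).
  rewrite /= -xkS; apply; apply: lt_le_trans h _.
  by rewrite lerD2l; exact: etaf.
have bnu k : b * lam k <= (lam k - 1) ^+ 2 / 4 + nu k ^+ 2.
  rewrite normsq_b ler_wpM2r //; first by rewrite ltW // rate_gt0.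
  by rewrite normsq_b_inv.
have D00 : 0 < D 0%N by exact: rate_gt0.
have D0 k : D 0%N <= D k.
  elim: k => // k IH; apply: le_trans IH _; rewrite DS ler_peMl //.
  by rewrite ltW // rate_gt0.
apply: filterS (affine_recursion_growth b0 eta0 (rate_gt0 _ _) DS NS lam1 bnu etaP
  (`|M| / D 0%N)) => k.
rewrite normsq_b normsq_b_inv ler_pM2r ?rate_gt0 // ler_pdivrMr // => h.
rewrite /closeness normsq_a -/(D k).
have := ler_norm M; have := D0 k; have := normsq_ge0 (mob_b (Gam k)); nra.
Qed.

End InfiniteProducts.

(** * Weak convergence of the images of the uniform measure *)

Section Representation.
Variable R : realType.
Local Notation C := (C R).
Local Notation mobius := (mobius R).
Local Notation circle := (circle R).
Implicit Types (F G P : mobius) (x y z : circle).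

(** Shows that the coefficients of G_n tend to infinity when
    [closeness (G_n) x] does, since [rate] is at most [4 |b|^2 + 2]. *)
Lemma closeness_le_normsq_b G x :
  closeness G x <= (1 + normsq (mob_b G)) * (4 * normsq (mob_b G) + 2).
Proof.
rewrite /closeness normsq_a; have B0 := normsq_ge0 (mob_b G).
rewrite ler_pM2l; last by lra.
have := normsq_b (mob_inv G) x; rewrite normsq_b_inv.
have := rate_gt0 (mob_inv G) x; have := sqr_ge0 (twist (mob_inv G) x).
set r := rate _ _; set B := normsq _; nra.
Qed.

Lemma mob_fun_diff0 G z :
  cval (mob_act G z) - mob_fun G 0 = cval z / (jac G z * (mob_a G)^*).
Proof.
have a0 : (mob_a G)^* != 0.
  by rewrite conjC_eq0 -normsq_eq0 normsq_a gt_eqF // ltr_wpDr ?normsq_ge0.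
have := jac_neq0 G z; rewrite cval_mob_act => jz.
rewrite -[cval z in RHS]mul1r -(mob_detC G) /mob_fun !mulr0 !add0r.
rewrite /jac in jz *; field; by rewrite jz a0.
Qed.

Lemma jac_diff G y z : jac G y - jac G z = (mob_b G)^* * (cval y - cval z).
Proof. by rewrite /jac; ring. Qed.

(** G(0) is close to x, so if G z is far from x it is far from G(0), and then
    [jac G z] is small by [mob_fun_diff0]; as [jac G] is affine with slope [conj b], two such points z
    are within a constant times [|b|^-2] of each other. *)
Lemma far_points_close G x y z (r : R) : 0 < r ->
  normsq (cval x - mob_fun G 0) <= r / 4 ->
  r <= normsq (cval x - cval (mob_act G y)) ->
  r <= normsq (cval x - cval (mob_act G z)) ->
  normsq (mob_b G) ^+ 2 * normsq (cval y - cval z) <= 16 / r.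
Proof.
move=> r0 xG far_y far_z.
have A0 : 0 < normsq (mob_a G) by rewrite normsq_a ltr_wpDr ?normsq_ge0.
have far (u : circle) : r <= normsq (cval x - cval (mob_act G u)) ->
    normsq (jac G u) * normsq (mob_a G) <= 4 / r.
  move=> far_u.
  have J0 : 0 < normsq (jac G u) by rewrite normsq_gt0 jac_neq0.
  have := normsqD_le (cval x - mob_fun G 0) (mob_fun G 0 - cval (mob_act G u)).
  rewrite addrA subrK -[normsq (mob_fun G 0 - _)]normsqN opprB mob_fun_diff0.
  rewrite normsqM normsq_cval mul1r normsqV normsqM normsq_conj => h.
  have : r / 4 <= (normsq (jac G u) * normsq (mob_a G))^-1 by lra.
  rewrite -[r / 4]invrK invf_div lef_pV2 // posrE ?divr_gt0 ?mulr_gt0 //.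
have hy := far _ far_y; have hz := far _ far_z.
have := normsqD_le (jac G y) (- jac G z).
rewrite normsqN jac_diff normsqM normsq_conj => h.
have BA : normsq (mob_b G) <= normsq (mob_a G) by rewrite normsq_a; lra.
have B0 := normsq_ge0 (mob_b G).
have N0 := normsq_ge0 (cval y - cval z).
have e : 16 / r = 2 * (4 / r + 4 / r) by field; rewrite gt_eqF.
rewrite e; move: hy hz h; set p := 4 / r; set n := normsq (cval y - _) in N0 *.
set a := normsq (mob_a G) in A0 BA *; set b := normsq (mob_b G) in BA B0 *.
move=> h1 h2 h3.
have : b * (b * n) <= a * (b * n) by rewrite ler_wpM2r // mulr_ge0.
have : a * (b * n) <= a * (2 * (normsq (jac G y) + normsq (jac G z))).
  by rewrite ler_pM2l.
lra.
Qed.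

(** The law of cosines for a chord. *)
Lemma turn_dist (s t : R) :
  normsq (cval (turn s) - cval (turn t)) = 2 - 2 * cos (2 * pi * (s - t)).
Proof.
rewrite mulrBr cosB /turn /normsq /re /im /=.
set a := 2 * pi * s; set b := 2 * pi * t.
have := cos2Dsin2 a; have := cos2Dsin2 b; lra.
Qed.

(** Nearby points of the circle have nearby angles, or else the angles are near
    the ends of the unit interval. The weak alternatives [t <= e] and [1 - e <= t] avoid
    distances modulo 1, and still describe a set of small measure. *)
Lemma turn_close (e : R) : 0 < e -> e <= 1 / 2 -> exists2 d : R, 0 < d &
  forall s t : R, 0 <= s <= 1 -> 0 <= t <= 1 ->
  normsq (cval (turn s) - cval (turn t)) < d ->
  [\/ `|t - s| <= e, t <= e | 1 - e <= t].
Proof.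
move=> e0 e2; have p0 := @pi_gt0 R.
have cose : cos (2 * pi * e) < 1.
  by rewrite -[ltRHS]cos0 ltr_cos ?in_itv /=; nra.
have mono u : e <= u -> u <= 1 - e -> cos (2 * pi * u) <= cos (2 * pi * e).
  move=> eu ue; have [u2|u2] := leP u (1 / 2).
    by rewrite leNgt ltr_cos ?in_itv /= -?leNgt; nra.
  have -> : cos (2 * pi * u) = cos (2 * pi * (1 - u)).
    rewrite -[RHS]cosN -[RHS]cosD2pi; congr cos.
    by move: (pi : R) => p; rewrite -mulr_natl; ring.
  by rewrite leNgt ltr_cos ?in_itv /= -?leNgt; nra.
exists (2 - 2 * cos (2 * pi * e)); first by lra.
move=> s t /andP[s0 s1] /andP[t0 t1]; rewrite turn_dist => h.
have [h1|h1] := leP t e; first by constructor 2.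
have [h2|h2] := leP (1 - e) t; first by constructor 3.
constructor 1; rewrite leNgt; apply/negP => ts.
have : cos (2 * pi * (s - t)) = cos (2 * pi * `|t - s|).
  case: (ger0P (t - s)) => _; last by rewrite opprB.
  by rewrite -cosN; congr cos; ring.
have := mono `|t - s| (ltW ts) _.
have u1 : `|t - s| <= 1 - e by rewrite ler_norml; lra.
move=> /(_ u1); lra.
Qed.

(** Off a set of measure at most [4 e] the function is at most [c],
    and on it at most [M]. *)
Lemma integral_uniform_small (h : measurableTypeR R -> R) (c M e s : R) :
  measurable_fun setT h -> 0 <= c -> 0 <= M -> 0 < e ->
  (forall t, 0 <= t <= 1 -> `|h t| <= M) ->
  (forall t, 0 <= t <= 1 -> c < `|h t| -> [\/ `|t - s| <= e, t <= e | 1 - e <= t]) ->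
  (`| \int[uniform_prob (@ltr01 R)]_t (h t)%:E | <= (c + M * (4 * e))%:E)%E.
Proof.
move=> mh c0 M0 e0 hM hbad.
have mh' : measurable_fun setT (fun t => `|(h t)%:E|%E).
  by apply: measurableT_comp => //; exact/measurable_EFinP.
apply: (le_trans (le_abse_integral _ measurableT _)).
  exact/measurable_EFinP.
rewrite integral_uniform // subr0 invr1 mul1e.
pose J : set (measurableTypeR R) := `[s - e, s + e] `|` (`[0, e] `|` `[1 - e, 1]).
have mJ : measurable J by do 2 (apply: measurableU => //).
have muJ : (lebesgue_measure J <= (4 * e)%:E)%E.
  have itv_le (a b d : R) : 0 <= d -> b - a = d ->
      (lebesgue_measure (`[a, b]%classic : set R) <= d%:E)%E.
    move=> d0 dE; rewrite -dE in d0 *; rewrite lebesgue_measure_itv /= lte_fin; case: ifPn => // _.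
  apply: (le_trans (measureU2 _ _ _)) => //; first exact: measurableU.
  have -> : (4 * e)%:E = ((2 * e)%:E + (e%:E + e%:E))%E.
    by rewrite -!EFinD; congr EFin; ring.
  apply: leeD; first by apply: itv_le; [lra|ring].
  apply: (le_trans (measureU2 _ _ _)) => //.
  by apply: leeD; apply: itv_le; try lra; ring.
pose g (t : measurableTypeR R) := (c + M * \1_J t)%:E.
apply: le_trans.
  apply: (@ge0_le_integral _ _ _ _ _ _ _ g) => //=.
  - exact: measurable_funTS.
  - apply/measurable_EFinP; apply: measurable_funTS; apply: measurable_funD => //.
    by apply: measurable_funM => //; exact: measurable_indic.
  move=> t; rewrite in_itv /= => t01; rewrite lee_fin indicE.
  have [hc|hc] := leP `|h t| c; first by rewrite (le_trans hc) // lerDl mulr_ge0.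
  have -> : t \in J.
    apply/mem_set; have /andP[t0 t1] := t01.
    case: (hbad t t01 hc) => ht; [left|right; left|right; right]; rewrite /= in_itv /=.
    - by move: ht; rewrite ler_norml; lra.
    - by rewrite t0.
    - by rewrite t1 ht.
  by rewrite mulr1 (le_trans (hM _ t01)) // lerDr.
have mI : measurable_fun setT (fun t : measurableTypeR R => (M * \1_J t)%:E).
  apply/measurable_EFinP.
  by apply: measurable_funM => //; exact: measurable_indic.
rewrite /g; under eq_integral do rewrite EFinD.
rewrite ge0_integralD //=; last 2 first.
- by move=> t _; rewrite lee_fin mulr_ge0.
- exact: measurable_funTS.
rewrite integral_cst //= lebesgue_measure_itv /= lte_fin ltr01 oppr0 adde0 mule1.
rewrite EFinD leeD2l //.
under eq_integral do rewrite EFinM.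
rewrite ge0_integralZl //=; last first.
  by apply/measurable_EFinP; apply: measurable_funTS; exact: measurable_indic.
rewrite integral_indic // EFinM lee_wpmul2l ?lee_fin //.
by apply: le_trans muJ; apply: le_measure; rewrite ?inE //; exact: measurableI.
Qed.

Lemma measurable_continuous_circle (f : circle -> R) :
  continuous f -> measurable_fun setT f.
Proof.
move=> cf; apply: (measurability _ (RGenOpens.measurableE R)).
move=> _ [_ [a [b ->]] <-]; rewrite setTI; apply: sub_sigma_algebra.
by apply: open_comp => // x _; apply: cf.
Qed.

Lemma continuous_circle_bounded (f : circle -> R) :
  continuous f -> exists2 M : R, 0 < M & forall x, `|f x| <= M.
Proof.
move=> cf.
have : compact (f @` [set: circle]).
  apply: continuous_compact; last exact: compact_circle.
  exact: continuous_subspaceT.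
move=> /compact_bounded [M [Mr MP]].
exists (`|M| + 1) => [|x]; first by rewrite ltr_wpDl.
by apply: (MP (`|M| + 1)); [rewrite (le_lt_trans (ler_norm M)) // ltrDl|exists x].
Qed.

(** For a continuous f, the angles at which [f (G_n y)] differs from
    [f x] by more than a given amount correspond to points that are far from x
    after applying G_n. By [far_points_close] these are pairwise close, so by
    [turn_close] their angles lie in a set of small measure. Its location depends
    on n, so that pointwise convergence may fail although convergence in measure
    holds. *)
Theorem represents_of_closeness (G : nat -> mobius) x :
  (forall M, \forall n \near \oo, M <= closeness (G n) x) -> represents G x.
Proof.
move=> gapG f cf.
have mf := measurable_continuous_circle cf.
rewrite integral_dirac // ?diracT ?mul1e; last exact/measurable_EFinP.
pose U := uniform_prob (@ltr01 R).
pose phi n (t : measurableTypeR R) := mob_act (G n) (turn t).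
have mphi n : measurable_fun setT (phi n).
  apply: measurableT_comp; first exact: measurable_mob_act.
  exact: measurable_turn.
have [M M0 fM] := continuous_circle_bounded cf.
have U1 : U setT = 1%E by exact: probability_setT.
have Ufin : (U setT < +oo)%E by rewrite U1 ltry.
have Uint (h : measurableTypeR R -> R) (K : R) : measurable_fun setT h -> (forall t, `|h t| <= K) ->
    (uniform_prob (@ltr01 R)).-integrable setT (EFin \o h).
  move=> mh hK; apply: measurable_bounded_integrable => //.
  exists K; split; first exact: num_real.
  by move=> L KL t _; exact: le_trans (hK t) (ltW KL).
have mfphi n : measurable_fun setT (fun t => f (phi n t)).
  exact: measurableT_comp.
have intE n : (\int[pushforward circle_measure (mob_act (G n))]_y (f y)%:E =
    \int[U]_t (f (phi n t))%:E)%E.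
  transitivity (\int[pushforward (uniform_prob (@ltr01 R)) (phi n)]_y (f y)%:E)%E => //.
  rewrite integral_pushforward //.
    exact/measurable_EFinP.
  by apply: (Uint _ M) => // t; exact: fM.
have diffE n : (\int[U]_t (f (phi n t))%:E - (f x)%:E =
    \int[U]_t (f (phi n t) - f x)%:E)%E.
  under [RHS]eq_integral do rewrite EFinB.
  rewrite integralB_EFin //.
  - congr (_ - _)%E.
    by rewrite integral_cst // -[X in (_ * X)%E]/(U setT) U1 mule1.
  - by apply: (Uint _ M) => // t; exact: fM.
  - by apply: (Uint _ `|f x|).
under eq_cvg do rewrite intE.
have fin n : (\int[U]_t (f (phi n t))%:E)%E \is a fin_num.
  by apply: (integrable_fin_num measurableT); apply: (Uint _ M) => // t; exact: fM.
apply: cvg_EFin; first by near=> n; exact: fin.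
apply/cvgrPdist_lt => eps eps0.
have e20 : 0 < eps / 2 by rewrite divr_gt0.
have /nbhs_circleP[r r0 fr] : nbhs x [set z | `|f x - f z| < eps / 2].
  by apply: (@cvgr_dist_lt _ _ _ (nbhs x) (nbhs_filter x) f (f x)) => //; exact: cf.
(* the exceptional angles contribute at most 2 M * 4 e <= eps / 4 *)
pose e := Num.min (1 / 2) (eps / (32 * M)).
have e0 : 0 < e by rewrite lt_min !divr_gt0 // mulr_gt0.
have eh : e <= 1 / 2 by rewrite ge_min lexx.
have eM : M * (32 * e) <= eps.
  have : e <= eps / (32 * M) by rewrite ge_min lexx orbT.
  by rewrite ler_pdivlMr ?mulr_gt0 //; lra.
have [d d0 dP] := turn_close e0 eh.
have r20 : 0 < r ^+ 2 by rewrite exprn_gt0.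
(* K d > 16 / r^2, so |b|^2 > K keeps the squared distance of two exceptional
   points below d *)
pose K := 16 / (r ^+ 2 * d) + 1.
have K1 : 1 <= K by rewrite lerDr divr_ge0 // ltW // mulr_gt0.
near=> n.
have gn : 4 / r ^+ 2 + ((1 + K) * (4 * K + 2) + 1) <= closeness (G n) x.
  by near: n; exact: gapG.
have K2 : 0 < (1 + K) * (4 * K + 2) by nra.
have r40 : 0 < 4 / r ^+ 2 by rewrite divr_gt0.
have xG : normsq (cval x - mob_fun (G n) 0) <= r ^+ 2 / 4.
  rewrite closeness_dist -[leRHS]invrK invf_div lef_pV2 ?posrE //; lra.
have BK : K < normsq (mob_b (G n)).
  rewrite ltNge; apply/negP => BK.
  have := closeness_le_normsq_b (G n) x; have := normsq_ge0 (mob_b (G n)); nra.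
pose bad t := 0 <= t <= 1 /\ eps / 2 < `|f (phi n t) - f x|.
have bad_far t : bad t -> r ^+ 2 <= normsq (cval x - cval (phi n t)).
  move=> [_]; apply: contraTT; rewrite -ltNge -leNgt => h.
  rewrite distrC ltW //; apply: fr; rewrite -ltr_sqr ?nnegrE ?cdist_ge0 ?ltW //.
  by rewrite /cdist sqr_sqrtr // normsq_ge0.
have bad_close s t : bad s -> bad t ->
    normsq (cval (turn s) - cval (turn t)) < d.
  move=> /bad_far hs /bad_far ht.
  have := far_points_close r20 xG hs ht.
  set B := normsq (mob_b _) in BK *; set m := normsq _ => h.
  have m0 : 0 <= m by exact: normsq_ge0.
  have B2 : K * m <= B ^+ 2 * m by rewrite ler_wpM2r //; nra.
  have Kd : 16 / r ^+ 2 + d = K * d.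
    by rewrite /K; field; rewrite !gt_eqF.
  rewrite ltNge; apply/negP => dm.
  have : K * d <= K * m by rewrite ler_pM2l //; lra.
  lra.
have [s sP] : exists s, forall t, bad t -> [\/ `|t - s| <= e, t <= e | 1 - e <= t].
  have [[s bs]|nb] := pselect (exists s, bad s); last first.
    by exists 0 => t bt; case: nb; exists t.
  exists s => t bt; apply: dP; [exact: bs.1|exact: bt.1|exact: bad_close].
have := @integral_uniform_small (fun t => f (phi n t) - f x) (eps / 2) (2 * M) e s.
rewrite -/U -diffE => /(_ _ _ _ e0).
have mh : measurable_fun setT (fun t => f (phi n t) - f x) by exact: measurable_funB.
move=> /(_ mh (ltW e20)).
have M20 : 0 <= 2 * M by rewrite mulr_ge0 // ltW.
move=> /(_ M20).
have hM t : 0 <= t <= 1 -> `|f (phi n t) - f x| <= 2 * M.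
  move=> _; apply: (le_trans (ler_normB _ _)).
  by have := fM (phi n t); have := fM x; lra.
move=> /(_ hM (fun t t01 tb => sP t (conj t01 tb))).
rewrite -(fineK (fin n)) -EFinB /= lee_fin distrC => h.
apply: le_lt_trans h _; lra.
Unshelve. all: by end_near. Qed.

End Representation.

(** * The space of infinite words *)

Section InfiniteWords.
Variable A : finType.

Lemma compact_infword : compact [set: infword A].
Proof.
have cA : compact [set: discrete_topology A] by apply: finite_compact; exact: finite_finset.
have := @tychonoff nat (fun=> discrete_topology A) (fun=> setT) (fun=> cA).
by congr compact; apply/seteqP.
Qed.

Lemma hausdorff_infword : hausdorff_space (infword A).
Proof.
apply: hausdorff_product => n; exact: discrete_hausdorff.
Qed.

Lemma nbhs_cylinder (w : infword A) N :
  nbhs w [set v : infword A | forall k, (k < N)%N -> v k = w k].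
Proof.
elim: N => [|N IH]; first by apply: filterS filterT => v _ k; rewrite ltn0.
have h : nbhs w [set v : infword A | v N = w N].
  apply: (@proj_continuous nat (fun=> discrete_topology A) N w [set a | a = w N]).
  exact: discrete_set1.
apply: filterS2 IH h => v vk vN k; rewrite ltnS leq_eqVlt => /orP[/eqP->//|].
exact: vk.
Qed.

(** The product of discrete topologies: each letter has to be locally
    constant. *)
Lemma continuous_infword (T : topologicalType) (f : T -> infword A) :
  (forall t n, nbhs t [set s | f s n = f t n]) -> continuous f.
Proof.
move=> cf t; apply/cvg_sup => i.
apply: (@continuous_comp_initial _ _ _ _ f).
move=> s U /nbhs_singleton Us; apply: filterS (cf s i) => r /= e.
by rewrite e.
Qed.

End InfiniteWords.

(** * Uniqueness of the represented point *)

Section Uniqueness.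
Variable R : realType.
Local Notation mobius := (mobius R).
Local Notation circle := (circle R).

(** The coordinates of the circle are continuous test functions. *)
Lemma represents_unique (G : nat -> mobius) (x y : circle) :
  represents G x -> represents G y -> x = y.
Proof.
move=> Gx Gy.
have eqf (f : circle -> R) : continuous f -> f x = f y.
  move=> cf; have := @cvg_unique _ (@ereal_hausdorff R) _
    (fmap_proper_filter _ eventually_filter) _ _ (Gx f cf) (Gy f cf).
  have mf := measurable_continuous_circle cf.
  by rewrite !integral_dirac // ?diracT ?mul1e; [case|exact/measurable_EFinP..].
apply: val_inj; rewrite -[\val x]reim_eta -[\val y]reim_eta.
by rewrite (eqf _ (@continuous_re R)) (eqf _ (@continuous_im R)).
Qed.

End Uniqueness.

(** * The subshift of block concatenations *)

Section BlockAutomaton.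
Variables (R : realType) (A : finType) (F : A -> mobius R) (a0 : A).
Variable bs : seq (seq A).
Local Notation mobius := (mobius R).
Local Notation circle := (circle R).

(** A word of [bs] with a position in it, which is meaningful for [valid] states.
    Keeping the position in the state makes reading letters a
    letter-to-letter map that commutes with the shift. *)
Definition state : finType := (seq_sub bs * 'I_(\max_(b <- bs) size b))%type.
Implicit Types (s t : state) (p : infword state) (x y : circle).

Definition block s : seq A := val s.1.
Definition pos s : nat := val s.2.
Definition letter s : A := nth a0 (block s) (pos s).
(** Composition of the letters of the current block that are already read. *)
Definition past s : mobius := mob_word F (take (pos s) (block s)).

Definition valid s : bool := (pos s < size (block s))%N.

Definition follows s t : bool :=
  if ((pos s).+1 < size (block s))%N
  then (t.1 == s.1) && (pos t == (pos s).+1) else pos t == 0%N.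

(** The expansion interval of the current block, seen from the point reached
    after reading its first [pos s] letters. *)
Definition state_arc s : set circle := [set y |
  expansion_interval_inv (mob_word F (block s)) (mob_act (past s) y)].

Definition read p : infword A := fun n => letter (p n).

Definition path_mob p n : mobius := mob_word F (prefix_word (read p) n).

(** The points whose itinerary may start with the first n + 1 states of p: an
    intersection of open arcs. *)
Definition window p n : set circle := [set y | forall k, (k <= n)%N ->
  state_arc (p k) (mob_act (mob_inv (path_mob p k)) y)].

Definition run p : Prop := forall n, valid (p n) /\ follows (p n) (p n.+1).

(** Closures are taken of the finite intersections, not of the arcs, so that for
    every n the represented point is a limit of points at which all the blocks
    met up to time n expand strictly. *)
Definition coding : set (infword state * circle) :=
  [set px | run px.1 /\ forall n, closure (window px.1 n) px.2].

Lemma state_arc_start s : pos s = 0%N ->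
  state_arc s = expansion_interval_inv (mob_word F (block s)).
Proof.
move=> s0; apply/seteqP.
by split=> y; rewrite /state_arc /= /past s0 take0 mob_act_id.
Qed.

Lemma mob_word_cat u v :
  mob_word F (u ++ v) = mob_comp (mob_word F u) (mob_word F v).
Proof.
by elim: u => [|a u IH] /=; rewrite ?mob_1comp // IH mob_compA.
Qed.

Lemma mob_word_rcons u a :
  mob_word F (rcons u a) = mob_comp (mob_word F u) (F a).
Proof. by rewrite -cats1 mob_word_cat /= mob_comp1. Qed.

Lemma path_mobS p n :
  path_mob p n.+1 = mob_comp (path_mob p n) (F (letter (p n))).
Proof. by rewrite /path_mob /prefix_word mkseqS mob_word_rcons. Qed.

Lemma path_mob0 p : path_mob p 0 = mob_id R.
Proof. by []. Qed.

Lemma mob_inv_id : mob_inv (mob_id R) = mob_id R.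
Proof. by apply: mob_eq; rewrite /= ?conjC1 ?oppr0. Qed.

Lemma path_mob_shift p n :
  path_mob p n.+1 = mob_comp (F (letter (p 0%N))) (path_mob (Defs.shift p) n).
Proof.
elim: n => [|n IH]; first by rewrite path_mobS !path_mob0 mob_1comp mob_comp1.
by rewrite path_mobS IH -mob_compA -path_mobS.
Qed.

Lemma eq_path_mob p p' n : (forall k, (k < n)%N -> p k = p' k) ->
  path_mob p n = path_mob p' n.
Proof.
elim: n => // n IH pp'; rewrite !path_mobS pp' // IH // => k kn.
by rewrite pp' // ltnW.
Qed.

Lemma eq_window p p' n : (forall k, (k <= n)%N -> p k = p' k) ->
  window p n = window p' n.
Proof.
move=> pp'; apply/seteqP; split=> y yW k kn; have := yW k kn.
  rewrite (pp' k kn) (@eq_path_mob p p') // => j jk.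
  by rewrite pp' // ltnW // (leq_trans jk).
rewrite (pp' k kn) (@eq_path_mob p p') // => j jk.
by rewrite pp' // ltnW // (leq_trans jk).
Qed.

(** Membership at stage n depends on a finite prefix of the run and on a
    closed condition on the point. *)
Lemma closed_coding : closed coding.
Proof.
move=> [p x] clpx.
have cyl n V : nbhs x V -> exists2 px', coding px' &
    (forall k, (k < n)%N -> px'.1 k = p k) /\ V px'.2.
  move=> xV.
  have : nbhs (p, x) ([set q : infword state | forall k, (k < n)%N -> q k = p k] `*` V).
    by exists ([set q : infword state | forall k, (k < n)%N -> q k = p k], V);
      [split => //; exact: nbhs_cylinder|].
  by move=> /clpx[px' [cpx' [h1 h2]]]; exists px'.
split=> n /=.
  have [[q y] [/= qrun _] [qp _]] := cyl n.+2 setT filterT.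
  by rewrite -!qp //; exact: qrun.
move=> V; rewrite nbhsE => -[Q [oQ Qx] QV].
have [[q y] [/= _ qcl] [qp Qy]] := cyl n.+1 Q (open_nbhs_nbhs (conj oQ Qx)).
have [z [zW Qz]] := qcl n Q (open_nbhs_nbhs (conj oQ Qy)).
by exists z; split; [rewrite (@eq_window p q) // => k kn; rewrite qp|exact: QV].
Qed.

(** The first map carries the window of the shifted run onto a set that
    contains the window of the run one step later. *)
Lemma coding_shift p x : coding (p, x) ->
  coding (Defs.shift p, mob_act (mob_inv (F (letter (p 0%N)))) x).
Proof.
move=> [/= prun pcl]; split => /= [n|n]; first exact: prun.
move=> V /(@continuous_mob_act R _ x) xV.
have [z [zW zV]] := pcl n.+1 _ xV.
exists (mob_act (mob_inv (F (letter (p 0%N)))) z); split => // k kn.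
have := zW k.+1 kn.
by rewrite path_mob_shift mob_inv_comp mob_actM.
Qed.

Lemma run_within p n m : run p -> (pos (p n) + m < size (block (p n)))%N ->
  block (p (n + m)%N) = block (p n) /\ pos (p (n + m)%N) = (pos (p n) + m)%N.
Proof.
move=> prun; elim: m => [|m IH] h; first by rewrite !addn0.
have [|e1 e2] := IH; first by rewrite (leq_trans _ h) // addnS.
have [_] := prun (n + m)%N; rewrite /follows e1 e2 -addnS h.
move=> /andP[/eqP h1 /eqP h2]; rewrite addnS; split=> //.
by rewrite -e1 /block h1.
Qed.

Lemma run_block_end p n : run p ->
  pos (p (n + (size (block (p n)) - pos (p n)))%N) = 0%N.
Proof.
move=> prun; have [v _] := prun n; move: v; rewrite /valid => v.
have [m e] : exists m, (size (block (p n)) - pos (p n) = m.+1)%N.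
  by exists (size (block (p n)) - pos (p n)).-1; rewrite prednK // subn_gt0.
have h : (pos (p n) + m.+1 = size (block (p n)))%N by rewrite -e subnKC // ltnW.
have [|e1 e2] := @run_within p n m prun; first by rewrite -h addnS.
have [_] := prun (n + m)%N; rewrite /follows e1 e2 -addnS h ltnn e addnS.
by move=> /eqP.
Qed.

Lemma path_mob_block p n m : run p -> pos (p n) = 0%N ->
  (m <= size (block (p n)))%N ->
  path_mob p (n + m) = mob_comp (path_mob p n) (mob_word F (take m (block (p n)))).
Proof.
move=> prun p0; elim: m => [|m IH] h; first by rewrite addn0 take0 mob_comp1.
have [|e1 e2] := @run_within p n m prun; first by rewrite p0.
rewrite addnS path_mobS IH ?(ltnW h) // (take_nth a0 h) mob_word_rcons mob_compA.
by rewrite /letter e1 e2 p0.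
Qed.

(** The first block of a run may have been entered in the middle, hence the
    subtraction of [pos]. *)
Fixpoint block_start p k : nat := if k is k'.+1
  then let n := block_start p k' in (n + (size (block (p n)) - pos (p n)))%N
  else (size (block (p 0%N)) - pos (p 0%N))%N.

Lemma pos_block_start p k : run p -> pos (p (block_start p k)) = 0%N.
Proof.
by move=> prun; case: k => [|k]; [exact: (@run_block_end p 0)|exact: run_block_end].
Qed.

Lemma block_start_lt p k : run p -> (block_start p k < block_start p k.+1)%N.
Proof.
move=> prun; have [v _] := prun (block_start p k).
by rewrite /= -[X in (X < _)%N]addn0 ltn_add2l subn_gt0.
Qed.

Lemma block_start_le p j k : run p -> (j <= k)%N ->
  (block_start p j <= block_start p k)%N.
Proof.
move=> prun; elim: k => [|k IH]; first by rewrite leqn0 => /eqP ->.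
rewrite leq_eqVlt => /orP[/eqP->//|]; rewrite ltnS => /IH h.
by rewrite (leq_trans h) // ltnW // block_start_lt.
Qed.

Lemma block_of p n : run p -> (block_start p 0 <= n)%N ->
  exists2 k, (block_start p k <= n)%N & (n < block_start p k.+1)%N.
Proof.
move=> prun; elim: n => [|n IH] h.
  exists 0%N => //; apply: leq_ltn_trans (block_start_lt 0 prun); exact: leq0n.
move: h; rewrite leq_eqVlt => /orP[/eqP h|/IH[k k1 k2]].
  by exists 0%N; rewrite ?h // -h block_start_lt.
have [h|h] := ltnP n.+1 (block_start p k.+1).
  by exists k => //; rewrite leqW.
exists k.+1 => //.
have -> : n.+1 = block_start p k.+1 by apply/eqP; rewrite eqn_leq h k2.
exact: block_start_lt.
Qed.

(** At the starts of blocks this is [product_closeness], the partial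
    product before the first full block being the initial value. In between, the
    partial product differs by one of the finitely many factors [past s]. *)
Theorem coding_closeness p x : coding (p, x) ->
  forall M, \forall n \near \oo, M <= closeness (path_mob p n) x.
Proof.
move=> [/= prun pcl] M.
pose t := block_start p.
have t0 k : pos (p (t k)) = 0%N by exact: pos_block_start.
have tS k : t k.+1 = (t k + size (block (p (t k))))%N.
  by rewrite /t /= pos_block_start // subn0.
have gapt : forall M, \forall k \near \oo, M <= closeness (path_mob p (t k)) x.
  apply: (@product_closeness R (seq_sub bs) (fun b => mob_word F (val b))
    (fun k => (p (t k)).1)).
    by move=> k; rewrite tS path_mob_block // take_size.
  move=> n V xV; have [z [zW zV]] := pcl (t n) V xV; exists z; split => // k kn.
  have := zW (t k) (block_start_le prun kn).
  by rewrite state_arc_start.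
have [|b b0 bP] := @finite_pos_lower_bound R state
    (fun s => (msize (past s) ^+ 2)^-1).
  by move=> s; rewrite invr_gt0 exprn_gt0 // msize_gt0.
have [K _ KP] := gapt (`|M| / b).
exists (t K) => // n /= Kn.
have [k k1 k2] := block_of prun (leq_trans (block_start_le prun (leq0n K)) Kn).
have Kk : (K <= k)%N.
  rewrite leqNgt; apply/negP => /(block_start_le prun) h.
  by have := leq_trans k2 (leq_trans h Kn); rewrite ltnn.
(* the block being read at time n starts at t k *)
have nE : n = (t k + (n - t k))%N by rewrite subnKC.
have nk : (n - t k < size (block (p (t k))))%N.
  by rewrite -(ltn_add2l (t k)) -nE -tS.
have [|e1 e2] := @run_within p (t k) (n - t k) prun; first by rewrite t0.
rewrite -nE in e1 e2.
have -> : path_mob p n = mob_comp (path_mob p (t k)) (past (p n)).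
  rewrite {1}nE (path_mob_block prun (t0 k) (ltnW nk)) /past.
  by rewrite e1 e2 t0 add0n.
apply: le_trans (closeness_comp _ _ _).
have := KP k Kk => /=; rewrite ler_pdivrMr //.
move=> h; apply: (le_trans (ler_norm M)); apply: (le_trans h).
rewrite ler_wpM2l //.
by rewrite mulr_ge0 ?normsq_ge0 // ltW // rate_gt0.
Qed.

Hypothesis bs_cover : forall x, exists2 b, b \in bs &
  closure (expansion_interval_inv (mob_word F b)) x.
Hypothesis bs_nonempty : forall b, b \in bs -> b <> [::].

Lemma open_expansion_interval (G : mobius) : open (expansion_interval_inv G).
Proof.
rewrite expansion_interval_invE.
have : open (rate (mob_inv G) @^-1` [set r | 1 < r]).
  apply: open_comp => [y _|]; [exact: continuous_rate|exact: open_gt].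
by [].
Qed.

(** A point of U lies in the closure of some expansion interval, which
    therefore meets U. *)
Lemma start_block (U : set circle) : open U -> U !=set0 ->
  exists2 s : state, valid s /\ pos s = 0%N & U `&` state_arc s !=set0.
Proof.
move=> oU [x Ux]; have [b bbs clb] := bs_cover x.
have [y [yV yU]] := clb U (open_nbhs_nbhs (conj oU Ux)).
have sz : (0 < size b)%N by have := bs_nonempty bbs; case: (b).
have bmax : (0 < \max_(b <- bs) size b)%N.
  apply: leq_trans sz _; exact: (@leq_bigmax_seq _ bs xpredT size).
pose s : state := (SeqSub bbs, Ordinal bmax).
exists s; first by [].
by rewrite state_arc_start //; exists y.
Qed.

(** A nonempty open set of points, in the current coordinates, that the
    block being read still expands. *)
Definition inhabited_state (Us : set circle * state) : Prop :=
  [/\ open Us.1, Us.1 !=set0, valid Us.2 & Us.1 `<=` state_arc Us.2].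

(** Within a block the set is only transported. At the end of a block it is
    cut down to the expansion interval of a new block that meets it. *)
Lemma extend_state (Us : set circle * state) : inhabited_state Us ->
  exists Vt : set circle * state, [/\ inhabited_state Vt, follows Us.2 Vt.2 &
    forall y, Vt.1 y -> Us.1 (mob_act (F (letter Us.2)) y)].
Proof.
case: Us => U s [/= oU [u Uu] vs Us].
pose U1 := mob_act (F (letter s)) @^-1` U.
have oU1 : open U1 by apply: open_comp => // y _; exact: continuous_mob_act.
have U1u : U1 (mob_act (mob_inv (F (letter s))) u) by rewrite /U1 /= mob_actVK.
have [h|h] := boolP ((pos s).+1 < size (block s))%N.
  have sz : ((pos s).+1 < \max_(b <- bs) size b)%N.
    apply: leq_trans h _; apply: (@leq_bigmax_seq _ bs xpredT size) => //.
    exact: valP.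
  pose t : state := (s.1, Ordinal sz).
  have tS : pos t = (pos s).+1 by [].
  have bt : block t = block s by [].
  exists (U1, t); split; last by [].
    split; [exact: oU1|by exists (mob_act (mob_inv (F (letter s))) u)|by rewrite /= /valid tS bt|].
    move=> y /Us; rewrite /state_arc /= /past tS bt (take_nth a0 vs).
    by rewrite mob_word_rcons mob_actM.
  by rewrite /follows /= h tS !eqxx.
have [t [vt pt] [y [yU1 yt]]] := start_block oU1 (ex_intro _ _ U1u).
exists (U1 `&` state_arc t, t); split; last by move=> z [].
  split; last by move=> z [].
  - apply: openI => //.
    apply: open_comp => [z _|]; first exact: continuous_mob_act.
    exact: open_expansion_interval.
  - by exists y.
  - exact: vt.
by rewrite /follows (negbTE h) /= pt.
Qed.

(** Dependent choice on [extend_state] gives a run whose windows all meet Q;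
    a cluster point of points of these intersections is coded by the run. *)
Lemma coding_dense (Q : set circle) : open Q -> Q !=set0 ->
  exists p x, coding (p, x) /\ closure Q x.
Proof.
move=> oQ Q0.
have [s0 [vs0 ps0] Qs0] := start_block oQ Q0.
have open_arc s : open (state_arc s).
  apply: open_comp => [z _|]; first exact: continuous_mob_act.
  exact: open_expansion_interval.
pose X := {Us : set circle * state | inhabited_state Us}.
have X0 : inhabited_state (Q `&` state_arc s0, s0).
  by split; [exact: openI|exact: Qs0|exact: vs0|move=> z []].
have step (u : X) : {v : X | follows (sval u).2 (sval v).2 /\
    forall y, (sval v).1 y -> (sval u).1 (mob_act (F (letter (sval u).2)) y)}.
  apply: cid; have [v [v1 v2 v3]] := extend_state (svalP u).
  by exists (exist _ v v1).
have [f [f0 fS]] := dependent_choice step (exist _ _ X0).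
pose p : infword state := fun n => (sval (f n)).2.
pose U n := (sval (f n)).1.
have inW n y : U n y -> forall k, (k <= n)%N ->
    U k (mob_act (mob_inv (path_mob p k)) (mob_act (path_mob p n) y)).
  elim: n y => [|n IH] y Uy k.
    by rewrite leqn0 => /eqP ->; rewrite mob_actK.
  rewrite leq_eqVlt => /orP[/eqP->|]; first by rewrite mob_actK.
  rewrite ltnS => kn; rewrite path_mobS mob_actM.
  by apply: IH => //; exact: (fS n).2.
have prun : run p.
  by move=> n; split; [have [] := svalP (f n)|exact: (fS n).1].
have Wn n : exists z, window p n z /\ Q z.
  have [_ [y Uy] _ _] := svalP (f n).
  exists (mob_act (path_mob p n) y); split.
    by move=> k kn; have [_ _ _] := svalP (f k); apply; exact: (inW n).
  have := inW n y Uy 0%N (leq0n n); rewrite /U f0 /= => -[].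
  rewrite mob_inv_id.
  by rewrite mob_act_id.
have [z zP] := choice Wn.
have [x [_ clx]] := @compact_circle R (z @ \oo) _ filterT.
exists p, x; split.
  split => //= n V xV; apply: clx xV.
  exists n => // m /= nm; have [h _] := zP m.
  by move=> k kn; apply: h; exact: leq_trans nm.
move=> V xV; apply: clx xV; exists 0%N => // m _; exact: (zP m).2.
Qed.

Definition coded_words : set (infword A) := (fun px => read px.1) @` coding.

Lemma compact_coding : compact coding.
Proof.
apply: (subclosed_compact closed_coding
  (compact_setX (compact_infword (A := state)) (@compact_circle R))).
by [].
Qed.

Lemma continuous_read : continuous (fun px : infword state * circle => read px.1).
Proof.
apply: continuous_infword => -[p x] n.
exists ([set q : infword state | forall k, (k < n.+1)%N -> q k = p k], setT).
  by split; [exact: nbhs_cylinder|exact: filterT].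
by move=> [q y] [/= qp _]; rewrite /read qp.
Qed.

Lemma coding_represents p x : coding (p, x) -> represents_word F (read p) x.
Proof.
move=> cpx; apply: represents_of_closeness => M.
have [N _ NP] := coding_closeness cpx M.
by exists N => // n Nn; exact: (NP n.+1 (leqW Nn)).
Qed.

(** [Phi] is a choice among represented points, and there is only one. *)
Lemma coding_Phi p x : coding (p, x) -> Phi F (read p) = x.
Proof.
move=> /coding_represents rx.
have h : represents_word F (read p) (Phi F (read p)) by apply: getPex; exists x.
exact: represents_unique h rx.
Qed.

Lemma closed_coded_words : closed coded_words.
Proof.
apply: compact_closed; first exact: hausdorff_infword.
apply: continuous_compact compact_coding.
exact: continuous_subspaceT continuous_read.
Qed.

Lemma shift_coded_words : @Defs.shift A @` coded_words `<=` coded_words.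
Proof.
move=> _ [_ [[p x] cpx <-] <-].
by exists (Defs.shift p, mob_act (mob_inv (F (letter (p 0%N)))) x);
  first exact: coding_shift.
Qed.

Lemma Phi_coded_words_onto : Phi F @` coded_words = [set: circle].
Proof.
have -> : Phi F @` coded_words = snd @` coding.
  apply/seteqP; split=> [_ [_ [[p x] cpx <-] <-]|_ [[p x] cpx <-]].
    by exists (p, x) => //=; rewrite (coding_Phi cpx).
  by exists (read p); [exists (p, x)|exact: coding_Phi].
have cl : closed (@snd (infword state) circle @` coding).
  apply: compact_closed; first exact: hausdorff_circle.
  apply: continuous_compact compact_coding.
  by apply: continuous_subspaceT => px; exact: cvg_snd.
apply/seteqP; split => // x _; apply: cl => V /nbhs_circleP[e e0 eV].
pose Q := [set z : circle | cdist (cval x) (cval z) < e / 2].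
have e2 : 0 < e / 2 by rewrite divr_gt0.
have [|p [y [cpy cly]]] := coding_dense (open_interior Q).
  by exists x; apply/nbhs_circleP; exists (e / 2).
exists y; split; first by exists (p, y).
have ny : nbhs y [set z : circle | cdist (cval y) (cval z) < e / 2].
  by apply/nbhs_circleP; exists (e / 2).
have [z [/interior_subset/= zx /= zy]] := cly _ ny.
apply: eV; apply: le_lt_trans (cdist_triangle (cval z) _ _) _.
by rewrite [ltRHS](splitr e) ltrD // cdistC.
Qed.

(** The inverse image of a closed set D is the image of the
    compact set of codings whose point is in D. *)
Lemma Phi_coded_words_continuous : {within coded_words, continuous (Phi F)}.
Proof.
apply/continuous_closedP => D cD; apply/closed_subspaceP.
exists ((fun px : infword state * circle => read px.1) @` (coding `&` (snd @^-1` D))).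
  apply: compact_closed; first exact: hausdorff_infword.
  apply: continuous_compact; first exact: continuous_subspaceT continuous_read.
  apply: (subclosed_compact _ compact_coding); last by move=> z [].
  apply: closedI; first exact: closed_coding.
  by apply: closed_comp => // px _; exact: cvg_snd.
apply/seteqP; split=> w [].
  move=> [[p x] [cpx Dx] <-] Sw; split => //.
  by rewrite /= /from_subspace /= (coding_Phi cpx : Phi F (read (p, x).1) = x).
move=> Dw [[p x] cpx e]; split; last by exists (p, x).
exists (p, x) => //; split => //=; rewrite /= -e /= in Dw.
by rewrite -(coding_Phi cpx).
Qed.

Theorem coded_words_number_system : mobius_number_system F coded_words.
Proof.
split.
- split; [exact: closed_coded_words|exact: shift_coded_words].
- by move=> _ [[p x] cpx <-]; exists x; exact: coding_represents.
- exact: Phi_coded_words_onto.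
- exact: Phi_coded_words_continuous.
Qed.

End BlockAutomaton.

Theorem corollary34 (R : realType) (A : finType) (F : A -> mobius R)
    (B : set (seq A)) :
  finite_set B ->
  (forall b, B b -> b <> [::]) ->
  [set: circle R] `<=`
    \bigcup_(b in B) closure (expansion_interval_inv (mob_word F b)) ->
  exists S : set (infword A), mobius_number_system F S.
Proof.
move=> /finite_seqP[bs ->] bs_nonempty bs_cover.
have [b0 b0bs _] := bs_cover point I.
have a0 : A by have := bs_nonempty _ b0bs; case: b0 {b0bs}.
exists (coded_words F a0 bs); apply: coded_words_number_system.
  by move=> x; have [b bbs clb] := bs_cover x I; exists b.
exact: bs_nonempty.
Qed.
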